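(* Suppose $X$ is a metric space, $f:X\to\mathbb{R}_\infty$, $\bar x\in X$, $\tau>0$, $\delta\in]0,+\infty]$ and $\mu\in]0,+\infty]$. (i) Let $X$ be complete, $f$ be lower semicontinuous, $\alpha\in]0,1]$, and either $\bar x\in[f\le0]$ or $\delta=+\infty$. Let $|\breve\nabla f|\in|\mathfrak{D}f|$. Then $f$ admits a $\tau$-error bound at $\bar x$ with $\delta':=\frac{\delta}{1+\alpha}$ and $\mu$, provided that $\alpha|\breve\nabla f|(u)\ge\tau$ for all $u\in B_\delta(\bar x)\cap[0<f<\mu]$ satisfying $$\max\{\alpha,1-\alpha\}f(u)<\tau\, d(u,[f\le0]).$$ (ii) If $f$ admits a $\tau$-error bound at $\bar x$ with $\delta$ and $\mu$, then $|\nabla f|^\diamond(u)\ge\tau$ for all $u\in B_\delta(\bar x)\cap[0<f<\mu]$. (iii) Let $X$ be a normed space, and $f$ be convex. If $f$ admits a $\tau$-error bound at $\bar x$ with $\delta$ and $\mu$, then $|\partial f|(u)\ge\tau$ for all $u\in B_\delta(\bar x)\cap[0<f<\mu]$.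
   Context: Notation: $\mathbb{R}_\infty=\mathbb{R}\cup\{+\infty\}$, $a_+=\max\{a,0\}$; $B_\delta(x)$ is the open ball, $B_{+\infty}(x)=X$; $d(x,\Omega)=\inf_{u\in\Omega}d(x,u)$ with $d(x,\emptyset)=+\infty$. For $f:X\to\mathbb{R}_\infty$: $\mathrm{dom} f=\{x\mid f(x)<+\infty\}$, $[f\le0]=\{x\mid f(x)\le0\}$, $[0<f<\mu]=\{x\mid 0<f(x)<\mu\}$. Normed spaces are metric spaces with the distance induced by the norm; $X^*$ is the dual. Error bound: $f$ admits a $\tau$-error bound at $\bar x$ with $\delta\in]0,+\infty]$ and $\mu\in]0,+\infty]$ if $\tau d(x,[f\le0])\le f(x)$ for all $x\in B_\delta(\bar x)\cap[0<f<\mu]$, and either $\bar x\in[f\le0]$ or $\delta=+\infty$. Slopes: for $x\in\mathrm{dom} f$, the slope is $|\nabla f|(x)=\limsup_{u\to x,\,u\ne x}\frac{[f(x)-f(u)]_+}{d(u,x)}$ and the nonlocal slope is $|\nabla f|^\diamond(x)=\sup_{u\ne x}\frac{[f(x)-f_+(u)]_+}{d(u,x)}$, where $f_+(u)=\max\{f(u),0\}$; both are $+\infty$ for $x\notin\mathrm{dom} f$. Subdifferentials in a normed space, for $x\in\mathrm{dom} f$ (all are empty for $x\notin\mathrm{dom} f$): Fréchet, $\partial^Ff(x)=\{x^*\in X^*\mid\liminf_{u\to x,u\neq x}\frac{f(u)-f(x)-\langle x^*,u-x\rangle}{\|u-x\|}\ge0\}$; Clarke, $\partial^Cf(x)=\{x^*\in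 X^*\mid\langle x^*,z\rangle\le f^\circ(x;z)\ \forall z\in X\}$, where $f^\circ(x;z)=\lim_{\varepsilon\downarrow0}\limsup_{(u,a)\to(x,f(x)),\,f(u)\le a,\,t\downarrow0}\inf_{\|z'-z\|<\varepsilon}\frac{f(u+tz')-a}{t}$. For convex $f$ both coincide with the convex subdifferential $\partial f(x)=\{x^*\in X^*\mid f(u)-f(x)-\langle x^*,u-x\rangle\ge0\ \forall u\in X\}$. Subdifferential slopes: $|\partial^Ff|(x)=d(0,\partial^Ff(x))$, $|\partial^Cf|(x)=d(0,\partial^Cf(x))$, $|\partial f|(x)=d(0,\partial f(x))$ (in the dual norm). Collection of slope operators: $|\mathfrak{D}f|$ contains $|\nabla f|^\diamond$ and $|\nabla f|$; if $X$ is a Banach space it also contains $|\partial^Cf|$; if $X$ is an Asplund space (a Banach space in which every separable subspace has separable dual) it also contains $|\partial^Ff|$. *)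

(* Defs.v *)
From HB Require Import structures.
From mathcomp Require Import all_boot all_order all_algebra.
From mathcomp Require Import all_classical all_reals all_analysis.

Set Implicit Arguments.
Unset Strict Implicit.
Unset Printing Implicit Defensive.

Import Order.TTheory GRing.Theory Num.Theory.
Import numFieldNormedType.Exports.

Local Open Scope classical_set_scope.
Local Open Scope ring_scope.
Local Open Scope ereal_scope.

(* Functions X -> R \cup {+oo} are represented as f : X -> \bar R together with
   the hypothesis [never_ninfty f]. *)
Definition never_ninfty (R : realType) (T : Type) (f : T -> \bar R) :=
  forall x, f x != -oo.

Section MetricSpace.
Context {R : realType} {X : metricType R}.
Implicit Types (f : X -> \bar R) (x u : X) (A : set X).

(* The library's completeness structures require a distinguished point. *)
Definition complete_space (Y : metricType R) :=
  forall F : set_system Y, ProperFilter F -> cauchy F -> exists l : Y, F --> l.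

Definition eball x (delta : \bar R) : set X :=
  [set u | (mdist x u)%:E < delta].

Definition dist_to A x : \bar R := ereal_inf [set (mdist x u)%:E | u in A].

Definition nonpos_set f : set X := [set x | f x <= 0].

Definition strip f (mu : \bar R) : set X := [set x | 0 < f x /\ f x < mu].

Definition error_bound f (xbar : X) (tau : R) (delta mu : \bar R) :=
  (forall x, eball xbar delta x -> strip f mu x ->
     tau%:E * dist_to (nonpos_set f) x <= f x) /\
  (nonpos_set f xbar \/ delta = +oo).

(* In both slopes, [maxe 0] fixes the supremum over the empty set (at an
   isolated point, resp. in a one-point space) to be 0 rather than -oo. *)
Definition slope f x : \bar R :=
  if f x == +oo then +oo
  else maxe 0
    (limf_esup (fun u => maxe 0 (f x - f u) / (mdist u x)%:E) x^').

Definition nonlocal_slope f x : \bar R :=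
  if f x == +oo then +oo
  else maxe 0
    (ereal_sup [set maxe 0 (f x - maxe (f u) 0) / (mdist u x)%:E |
                u in [set u | u != x]]).

End MetricSpace.

Section NormMetric.
Context {R : realType} (V : normedModType R).

Let ndist (x y : V) : R := `|x - y|%R.

Let ndist_ge0 x y : (0 <= ndist x y)%R.
Proof. exact: normr_ge0. Qed.

Let ndist_eq0 x y : ndist x y = 0%R -> x = y.
Proof. by move=> /normr0_eq0/eqP; rewrite subr_eq0 => /eqP. Qed.

Let ball_ndist x d : ball x d = [set y | (ndist x y < d)%R].
Proof. by rewrite -ball_normE. Qed.

(* A normed space seen as a metric space for the distance `|x - y|; its
   carrier, topology and uniformity are those of V. *)
Definition normed_metric : metricType R :=
  HB.pack_for (metricType R) (NormedModule.sort V)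
    (@PseudoMetric_isMetric.Build R V ndist ndist_ge0 ndist_eq0 ball_ndist).

End NormMetric.

Section NormedSpace.
Context {R : realType} {V : normedModType R}.
Implicit Types (f : V -> \bar R) (x z : V).

(* The norm of (the restriction to the linear subspace Y of) a functional. *)
Definition functional_norm (Y : set V) (g : V -> R) : \bar R :=
  ereal_sup [set `|g z|%:E | z in [set z | Y z /\ (`|z| <= 1)%R]].

(* d(0, S) for a set S of functionals, in the dual norm *)
Definition subdiff_slope (S : set {linear V -> R^o}) : \bar R :=
  ereal_inf [set functional_norm setT xs | xs in S].

Definition frechet_subdiff f x : set {linear V -> R^o} :=
  [set xs : {linear V -> R^o} | [/\ f x < +oo, continuous xs &
    0 <= limf_einf
           (fun u => (f u - f x - (xs (u - x)%R)%:E) / (`|u - x|%R)%:E) x^']].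

(* The filter of ((u, a), t) with u --> x, a --> f x, f u <= a and t --> 0+ *)
Definition clarke_filter f x : set_system (V * R * R) :=
  filter_prod
    (within [set p : V * R | f p.1 <= p.2%:E] (nbhs (x, fine (f x))))
    (0%R : R)^'+.

Definition clarke_dd f x z : \bar R :=
  lim ((limf_esup
          (fun p : V * R * R =>
             ereal_inf [set (f (p.1.1 + p.2 *: z')%R - p.1.2%:E) / p.2%:E |
                        z' in [set z' | (`|z' - z| < e)%R]])
          (clarke_filter f x)) @[e --> (0%R : R)^'+]).

Definition clarke_subdiff f x : set {linear V -> R^o} :=
  [set xs : {linear V -> R^o} | [/\ f x < +oo, continuous xs &
    forall z, (xs z)%:E <= clarke_dd f x z]].

Definition convex_subdiff f x : set {linear V -> R^o} :=
  [set xs : {linear V -> R^o} | [/\ f x < +oo, continuous xs &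
    forall u, 0 <= f u - f x - (xs (u - x)%R)%:E]].

Definition frechet_slope f x := subdiff_slope (frechet_subdiff f x).
Definition clarke_slope f x := subdiff_slope (clarke_subdiff f x).
Definition convex_slope f x := subdiff_slope (convex_subdiff f x).

Definition econvex f := forall (x y : V) (t : R), (0 < t < 1)%R ->
  f (t *: x + (1 - t) *: y)%R <= t%:E * f x + (1 - t)%:E * f y.

Definition separable_set (Y : set V) :=
  exists D : set V, [/\ countable D, D `<=` Y & Y `<=` closure D].

(* The dual of the linear subspace Y. Its elements are represented by functions
   on the whole of V of which only the restriction to Y matters: two functions
   that agree on Y are at distance 0 for [functional_norm Y]. *)
Definition dual_on (Y : set V) : set (V -> R) :=
  [set g | (forall (a : R) (y z : V), Y y -> Y z ->
              g (a *: y + z)%R = (a * g y + g z)%R)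
           /\ {within Y, continuous g}].

Definition separable_dual (Y : set V) :=
  exists D : set (V -> R), [/\ countable D, D `<=` dual_on Y &
    forall g, dual_on Y g -> forall e : R, (0 < e)%R ->
      exists2 h, D h & functional_norm Y (g - h)%R < e%:E].

End NormedSpace.

Definition asplund (R : realType) (V : completeNormedModType R) :=
  forall Y : set V, GRing.submod_closed [in Y] ->
    separable_set Y -> separable_dual Y.

(* [slope_operator X s]: s belongs to the collection of slope operators of the
   metric space X. *)
Inductive slope_operator (R : realType) :
    forall X : metricType R, ((X -> \bar R) -> X -> \bar R) -> Prop :=
| slope_operator_nonlocal (X : metricType R) :
    @slope_operator R X nonlocal_slope
| slope_operator_local (X : metricType R) :
    @slope_operator R X slope
| slope_operator_clarke (V : completeNormedModType R) :
    @slope_operator R (normed_metric V) (@clarke_slope R V)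
| slope_operator_frechet (V : completeNormedModType R) : asplund V ->
    @slope_operator R (normed_metric V) (@frechet_slope R V).

(* Main.v *)
From HB Require Import structures.
Require Import Defs.
From mathcomp Require Import all_boot all_order all_algebra.
From mathcomp Require Import all_classical all_reals all_analysis.
From mathcomp Require Import ring lra.
Set Implicit Arguments.
Unset Strict Implicit.
Unset Printing Implicit Defensive.
Import Order.TTheory GRing.Theory Num.Theory.
Import numFieldNormedType.Exports.
Local Open Scope classical_set_scope.
Local Open Scope ring_scope.

(** Part (i) rests on one property of a slope operator s, called
[ekeland_property] below. Given a lower semicontinuous f with f x0 = a >= 0,
0 < sigma < c and m > a, there is a point u with
max (f u) 0 + sigma * d(u, x0) <= m such that s f u <= c as soon as f u > 0.
Granting it, suppose that the error bound fails at a point x of the smaller ball,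
that is f x < tau * d(x, S) with S = [f <= 0]. Choose L with f x < tau * L and
L < d(x, v) for every v in S, and then sigma < c < tau / alpha with
f x < sigma * (alpha * L). The point u obtained from x0 = x lies within
alpha * L of x, hence outside of S, inside the larger ball, and satisfies the
extra inequality of the hypothesis; so alpha * s f u >= tau, which contradicts
s f u <= c ([ekeland_error_bound]).

The Ekeland property is proved for the four families of slopes from one
variational principle ([variational_principle]): the function F = max(f, 0) is
perturbed successively by multiples, of total mass c, of gauges Theta that are
1-Lipschitz and differ from the distance by an arbitrarily small error.

- With Theta the distance itself this is Ekeland's principle: F + c * d(., u)
  is minimal at u, which bounds the two metric slopes at once. For the Clarke
  slope, minimality gives f^0(u; z) >= - c * |z|; as f^0(u; .) is sublinear
  (Rockafellar), a Hahn-Banach sandwich yields a Clarke subgradient of norm at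
  most c ([clarke_subgradient]).

- For the Frechet slope in an Asplund space the gauges have to be smooth. On a
  separable subspace Y with separable dual, take
  theta x = sup (p x - eps * rho p) over the dual unit ball, with a strictly
  convex penalty rho such that near-maximizers converge in norm on Y; this is
  the conjugate form of the Kadets-Klee renorming ([smooth_norm],
  [near_maximizer_uniform]). Then theta has Frechet supergradients, and the
  minimality of a point of Y gives a Frechet subgradient along Y.

- Finally, a separable Y can be chosen so rich that the existence at a point
  of Y of a Frechet subgradient along Y of norm at most c implies its existence
  on the whole space ([separable_reduction]). By the sandwich lemma the failure
  of existence is always witnessed by finitely many points, and Y is the closure
  of a countable set that is stable under the choice of such witnesses.

Parts (ii) and (iii) need none of this. A slope b at u gives f u <= b * d(u, v)
for every v in S, and this together with tau * d(u, S) <= f u and f u > 0 forces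
tau <= b ([error_bound_growth]). *)

(** * The Hahn-Banach theorem and a sandwich lemma *)

Section HahnBanach.
Context {R : realType} {V : lmodType R}.
Implicit Types (p q : V -> R).

Definition sublinear p :=
  (forall x y, p (x + y) <= p x + p y) /\
  (forall t x, 0 < t -> p (t *: x) <= t * p x).

Lemma sublinear0 p : sublinear p -> p 0 = 0.
Proof.
move=> [pD pZ]; have := pZ 2 0 (ltr0Sn _ _); have := pZ 2^-1 0.
rewrite !scaler0 invr_gt0 => /(_ (ltr0Sn _ _)); lra.
Qed.

Lemma sublinearN p x : sublinear p -> - p (- x) <= p x.
Proof.
move=> sp; have := sp.1 x (- x); rewrite subrr (sublinear0 sp); lra.
Qed.

Lemma sublinearZ p t x : sublinear p -> 0 < t -> p (t *: x) = t * p x.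
Proof.
move=> [_ pZ] t0; apply/eqP; rewrite eq_le pZ//=.
have := pZ t^-1 (t *: x); rewrite invr_gt0 => /(_ t0).
by rewrite scalerK ?gt_eqF// ler_pdivlMl.
Qed.

(** Zorn's lemma applies because a chain of sublinear functions below q is bounded
    below by x |-> - q (- x), so that its pointwise infimum is again sublinear. *)
Lemma sublinear_minimal q : sublinear q -> exists2 p, sublinear p /\
  (forall x, p x <= q x) & forall p', sublinear p' -> (forall x, p' x <= p x) ->
  p' = p.
Proof.
move=> sq.
pose T := {p : V -> R | sublinear p /\ forall x, p x <= q x}.
pose le (a b : T) := `[< forall x, sval b x <= sval a x >].
have [[p [sp pq]] pmin] : exists t : T, forall s, le t s -> s = t.
  apply: Zorn.
  - by move=> t; apply/asboolP => x.
  - move=> r s t /asboolP rs /asboolP st; apply/asboolP => x.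
    exact: le_trans (rs x).
  - move=> [s hs] [t ht] /asboolP/= st /asboolP/= ts; apply: eq_exist.
    by apply/funext => x; apply/le_anti; rewrite st ts.
  move=> A Atot; have [[a0 Aa0]|A0] := pselect (A !=set0); last first.
    by exists (exist _ q (conj sq (fun x => lexx _))) => s As; case: A0; exists s.
  pose E x := [set sval a x | a in A].
  have Enb x : has_lbound (E x).
    exists (- q (- x)) => _ [[a [sa aq]] /= _ <-].
    by apply: le_trans (sublinearN x sa); rewrite lerN2.
  have En0 x : E x !=set0 by exists (sval a0 x); exists a0.
  pose m x := inf (E x).
  have mle a x : A a -> m x <= sval a x by move=> Aa; apply: ge_inf => //; exists a.
  have m_lt x e : m x < e -> exists2 a, A a & sval a x < e.
    move=> xe; have e0 : 0 < e - m x by rewrite subr_gt0.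
    have [_ [a Aa <-]] := inf_adherent e0 (conj (En0 x) (Enb x)).
    by rewrite addrC subrK => ?; exists a.
  have sm : sublinear m.
    split.
      move=> x y; apply/ler_addgt0Pr => e e0.
      have [a Aa ax] : exists2 a, A a & sval a x < m x + e / 2 by apply: m_lt; lra.
      have [b Ab bx] : exists2 b, A b & sval b y < m y + e / 2 by apply: m_lt; lra.
      have [c [Ac ca cb]] : exists c, [/\ A c, sval c x <= sval a x
          & sval c y <= sval b y].
        by case: (Atot _ _ Aa Ab) => /asboolP h; [exists b|exists a].
      have := mle c (x + y) Ac; have := (svalP c).1.1 x y; lra.
    move=> t x t0; rewrite -ler_pdivrMl//; apply: lb_le_inf => // _ [a Aa <-].
    rewrite ler_pdivrMl//; apply: le_trans (mle _ _ Aa) _.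
    exact: (svalP a).1.2.
  have mq x : m x <= q x by apply: le_trans (mle a0 x Aa0) _; exact: (svalP a0).2.
  by exists (exist _ m (conj sm mq)) => s As; apply/asboolP => x; exact: mle.
exists p => // p' sp' p'p.
have p'q x : p' x <= q x by exact: le_trans (pq x).
apply: (congr1 sval (pmin (exist _ p' (conj sp' p'q)) _)).
exact/asboolP.
Qed.

(** For fixed y the function z |-> inf (p (z + t y) - t p y) over t >= 0 is
    sublinear and below p, hence equal to p by minimality; t = 1 gives
    p x <= p (x + y) - p y, the missing half of additivity. *)
Lemma minimal_sublinear_linear p : sublinear p ->
  (forall p', sublinear p' -> (forall x, p' x <= p x) -> p' = p) ->
  linear (p : V -> R^o).
Proof.
move=> sp pmin.
have padd x y : p (x + y) = p x + p y.
  apply/eqP; rewrite eq_le sp.1 /=.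
  pose E z := [set p (z + t *: y) - t * p y | t in [set t : R | 0 <= t]].
  have En0 z : E z !=set0 by eexists; exists 0; rewrite /=.
  have Enb z : has_lbound (E z).
    exists (- p (- z)) => _ [t /= t0 <-].
    have -> : t * p y = p (t *: y).
      have [->|t1] := eqVneq t 0; first by rewrite scale0r (sublinear0 sp) mul0r.
      by rewrite sublinearZ// lt_neqAle eq_sym t1.
    have := sp.1 (z + t *: y) (- z); rewrite addrAC subrr add0r; lra.
  pose m z := inf (E z).
  have mle z t : 0 <= t -> m z <= p (z + t *: y) - t * p y.
    by move=> t0; apply: ge_inf => //; exists t.
  have m_lt z e : m z < e -> exists2 t, 0 <= t & p (z + t *: y) - t * p y < e.
    move=> xe; have e0 : 0 < e - m z by rewrite subr_gt0.
    have [_ [t t0 <-]] := inf_adherent e0 (conj (En0 z) (Enb z)).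
    by rewrite [ltRHS]addrC subrK => ?; exists t.
  have mp : m = p.
    apply: pmin; last first.
      by move=> z; have := mle z 0 (lexx _); rewrite scale0r addr0 mul0r subr0.
    split.
      move=> a b; apply/ler_addgt0Pr => e e0.
      have [t t0 ta] : exists2 t, 0 <= t &
        p (a + t *: y) - t * p y < m a + e / 2 by apply: m_lt; lra.
      have [s s0 sb] : exists2 t, 0 <= t &
        p (b + t *: y) - t * p y < m b + e / 2 by apply: m_lt; lra.
      have := mle (a + b) (t + s) (addr_ge0 t0 s0).
      rewrite scalerDl addrACA; have := sp.1 (a + t *: y) (b + s *: y); lra.
    move=> t x' t0; rewrite -ler_pdivrMl//; apply: lb_le_inf => // _ [s /= s0 <-].
    rewrite ler_pdivrMl//; apply: le_trans (mle _ (t * s) _) _.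
      by rewrite mulr_ge0// ltW.
    by rewrite -scalerA -scalerDr sublinearZ// -mulrA -mulrBr.
  have := mle x 1 ler01; rewrite mp scale1r; lra.
move=> t x y; rewrite padd; congr (_ + _).
have pN z : p (- z) = - p z.
  by have := padd z (- z); rewrite subrr (sublinear0 sp); lra.
change (p (t *: x) = t * p x).
have [t0|t0|<-] := ltgtP 0 t; first by rewrite sublinearZ.
  have := @sublinearZ p (- t) x sp; rewrite oppr_gt0 scaleNr pN => /(_ t0); lra.
by rewrite scale0r mul0r (sublinear0 sp).
Qed.

Lemma linear_of_fun p : linear (p : V -> R^o) ->
  exists g : {linear V -> R^o}, forall x, g x = p x.
Proof.
move=> lp; pose pL := GRing.isLinear.Build R V R^o *:%R p lp.
pose g : {linear V -> R^o} := HB.pack p pL.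
by exists g.
Qed.

Lemma hahn_banach q : sublinear q ->
  exists g : {linear V -> R^o}, forall x, g x <= q x.
Proof.
move=> /sublinear_minimal[p [sp pq] pmin].
have [g gp] := linear_of_fun (minimal_sublinear_linear sp pmin).
by exists g => x; rewrite gp.
Qed.

End HahnBanach.

Section Sandwich.
Context {R : realType} {V : normedModType R}.

Definition dual_ball (c : R) : set {linear V -> R^o} :=
  [set p | forall x, `|p x| <= c * `|x|].

(** A convex cone K of constraints p z <= b is satisfiable by a functional of norm
    at most c as soon as no single constraint in K contradicts the norm bound: the
    infimal convolution of K with c * |.| is a finite sublinear function, and any
    linear function below it works. *)
Lemma sandwich (c : R) (K : set (V * R)) : 0 <= c ->
  (forall k l, K k -> K l -> K (k.1 + l.1, k.2 + l.2)) ->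
  (forall t k, 0 < t -> K k -> K (t *: k.1, t * k.2)) ->
  (forall k, K k -> - (c * `|k.1|) <= k.2) ->
  exists2 p, dual_ball c p & forall k, K k -> p k.1 <= k.2.
Proof.
move=> c0 KD KZ Kc.
pose K0 := [set k | K k \/ k = (0, 0)].
have K0D k l : K0 k -> K0 l -> K0 (k.1 + l.1, k.2 + l.2).
  move=> [Kk|->] [Kl|->] /=; rewrite ?add0r ?addr0 -?surjective_pairing /K0 /=;
  by [left; exact: KD|left|right].
have K0Z t k : 0 < t -> K0 k -> K0 (t *: k.1, t * k.2).
  by move=> t0 [Kk|->]; [left; exact: KZ|right; rewrite /= scaler0 mulr0].
have K0c k : K0 k -> - (c * `|k.1|) <= k.2.
  by move=> [/Kc//|->]; rewrite /= normr0 mulr0 oppr0.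
pose E x := [set k.2 + c * `|x - k.1| | k in K0].
have En0 x : E x !=set0 by eexists; exists (0, 0) => //; right.
have Ege x y : E x y -> - (c * `|x|) <= y.
  move=> [k Kk <-]; have := K0c k Kk.
  have : c * `|k.1| <= c * (`|x| + `|x - k.1|).
    by apply: ler_wpM2l => //; rewrite -[in leLHS](subKr x k.1) ler_normB.
  lra.
have Enb x : has_lbound (E x) by exists (- (c * `|x|)) => y /Ege.
pose q x := inf (E x).
have qle x k : K0 k -> q x <= k.2 + c * `|x - k.1|.
  by move=> Kk; apply: ge_inf => //; exists k.
have q_lt x e : q x < e -> exists2 k, K0 k & k.2 + c * `|x - k.1| < e.
  move=> xe; have e0 : 0 < e - q x by rewrite subr_gt0.
  have [_ [t t0 <-]] := inf_adherent e0 (conj (En0 x) (Enb x)).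
  by rewrite [ltRHS]addrC subrK => ?; exists t.
have [p pq] : exists g : {linear V -> R^o}, forall x, g x <= q x.
  apply: hahn_banach; split.
    move=> x y; apply/ler_addgt0Pr => e e0.
    have [k Kk xk] : exists2 k, K0 k & k.2 + c * `|x - k.1| < q x + e / 2.
      by apply: q_lt; lra.
    have [l Kl yl] : exists2 k, K0 k & k.2 + c * `|y - k.1| < q y + e / 2.
      by apply: q_lt; lra.
    have /= := qle (x + y) _ (K0D _ _ Kk Kl).
    have : c * `|x + y - (k.1 + l.1)| <= c * (`|x - k.1| + `|y - l.1|).
      by apply: ler_wpM2l => //; rewrite opprD addrACA ler_normD.
    lra.
  move=> t x t0; rewrite -ler_pdivrMl//; apply: lb_le_inf => // _ [k Kk <-].
  rewrite ler_pdivrMl//; apply: le_trans (qle _ _ (K0Z _ _ t0 Kk)) _ => /=.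
  rewrite -scalerBr normrZ gtr0_norm//; lra.
have pc x : p x <= c * `|x|.
  apply: le_trans (pq x) _; have := qle x (0, 0); rewrite /= subr0 add0r.
  by apply; right.
exists p => [x|k Kk]; last first.
  apply: le_trans (pq _) _; have := qle k.1 k; rewrite subrr normr0 mulr0 addr0.
  by apply; left.
rewrite ler_norml pc andbT lerNl -[leLHS]linearN; apply: le_trans (pc _) _.
by rewrite normrN.
Qed.

Lemma norming_functional (x : V) : exists2 p, dual_ball 1 p & p x = `|x|.
Proof.
have [|t k|k [t /= t0 ->]|p pb pK] := @sandwich 1
    [set k | exists2 t : R, 0 < t & k = (- (t *: x), - (t * `|x|))] ler01.
- move=> _ _ [t t0 ->] [s s0 ->] /=; exists (t + s); first exact: addr_gt0.
  by rewrite scalerDl mulrDl !opprD.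
- move=> t0 [s s0 ->] /=; exists (t * s); first exact: mulr_gt0.
  by rewrite -scalerA -mulrA scalerN mulrN.
- by rewrite /= normrN normrZ gtr0_norm// mul1r.
exists p => //; apply/le_anti/andP; split.
  by have := pb x; rewrite mul1r; apply: le_trans; exact: ler_norm.
have := pK (- x, - `|x|); rewrite /= linearN lerN2; apply.
by exists 1; rewrite // scale1r mul1r.
Qed.

Lemma dual_ball_continuous c (p : {linear V -> R^o}) :
  dual_ball c p -> continuous p.
Proof.
move=> pc; apply/bounded_linear_continuous/linear_boundedP; near=> r => x.
by apply: le_trans (pc x) _; apply: ler_wpM2r.
Unshelve. all: by end_near. Qed.

End Sandwich.

(** * A variational principle with general gauges *)

Lemma half_expn_small (R : realType) (C e : R) : 0 < e ->
  \forall n \near \oo, C * 2^-1 ^+ n < e.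
Proof.
move=> e0; have C0 : 0 < `|C| + 1 by apply: ltr_wpDl.
have d0 : 0 < e / (`|C| + 1) by exact: divr_gt0.
near=> n; apply: (@le_lt_trans _ _ ((`|C| + 1) * 2^-1 ^+ n)).
  by apply: ler_wpM2r; rewrite ?exprn_ge0 ?invr_ge0// ler_wpDr// ler_norm.
rewrite mulrC -ltr_pdivlMr//.
have : 1 / 2 ^+ n < (PosNum d0)%:num.
  by near: n; exact: near_infty_natSinv_expn_lt.
by rewrite mul1r exprVn.
Unshelve. all: by end_near. Qed.

Section Variational.
Context {R : realType} {X : metricType R}.
Implicit Types (F : X -> \bar R) (x y z : X).

(** The form in which lower semicontinuity is used: upper bounds along a convergent
    sequence pass to its limit. *)
Lemma lsc_le F (v : nat -> X) x (l : R) : lower_semicontinuous F ->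
  v @ \oo --> x ->
  (forall e, 0 < e -> \forall i \near \oo, (F (v i) <= (l + e)%:E)%E) ->
  (F x <= l%:E)%E.
Proof.
move=> Flsc vx Fv; rewrite leNgt; apply/negP => lF.
have [a la aF] : exists2 a : R, l < a & (a%:E < F x)%E.
  move: lF; case: (F x) => [r| |//].
    by rewrite lte_fin => lr; exists ((l + r) / 2); rewrite ?lte_fin; lra.
  by move=> _; exists (l + 1); [lra|exact: ltry].
have [U xU UF] := Flsc _ _ aF.
have [i] : exists i, U (v i) /\ (F (v i) <= (l + (a - l))%:E)%E.
  apply: (@filter_ex _ \oo); apply: filterI; first exact: vx.
  by apply: Fv; lra.
move=> [/UF aFi]; rewrite addrC subrK => /(lt_le_trans aFi).
by rewrite ltxx.
Qed.

Lemma geometric_cvg (C : R) (u : nat -> X) : complete_space X ->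
  (forall i, mdist (u i.+1) (u i) <= C * 2^-1 ^+ i) ->
  exists x, u @ \oo --> x.
Proof.
move=> cX uC.
have C0 : 0 <= C.
  by have := uC 0%N; rewrite expr0 mulr1; apply: le_trans; exact: mdist_ge0.
have uk i k : mdist (u (i + k)%N) (u i) <=
    2 * C * 2^-1 ^+ i * (1 - 2^-1 ^+ k).
  elim: k => [|k IH]; first by rewrite addn0 mdistxx expr0 subrr mulr0.
  rewrite addnS; apply: le_trans (metric_triangle _ (u (i + k)%N) _) _.
  have := uC (i + k)%N; move: IH; rewrite exprD exprS; lra.
suff /cX[x ux] : cauchy (u @ \oo) by exists x.
apply: cauchy_exP => e e0.
have [N _ HN] := half_expn_small (2 * C) e0.
exists (u N); exists N => // n /= Nn; rewrite ballEmdist/= metric_sym.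
rewrite -(subnKC Nn); apply: le_lt_trans (uk _ _) _.
apply: le_lt_trans (HN N (leqnn _)).
rewrite ler_piMr//; first by rewrite !mulr_ge0// exprn_ge0// invr_ge0.
Qed.

Lemma near_minimizer F (Y : set X) (Phi : X -> R) (B b : R) x :
  (forall y, 0 <= F y)%E -> (forall y, - B <= Phi y) -> 0 < b ->
  Y x -> F x \is a fin_num ->
  exists y, [/\ Y y, F y \is a fin_num, fine (F y) + Phi y <= fine (F x) + Phi x
    & forall z, Y z -> F z \is a fin_num ->
        fine (F y) + Phi y <= fine (F z) + Phi z + b].
Proof.
move=> F0 PhiB b0 Yx Fx.
pose E := [set fine (F z) + Phi z | z in [set z | Y z /\ F z \is a fin_num]].
have Enb : has_lbound E.
  exists (- B) => _ [z [_ _] <-]; rewrite ler_wpDl//.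
  by apply: fine_ge0.
have En0 : E !=set0 by eexists; exists x.
have infle z : Y z -> F z \is a fin_num -> inf E <= fine (F z) + Phi z.
  by move=> Yz Fz; apply: ge_inf => //; exists z.
have [xle|xgt] := leP (fine (F x) + Phi x) (inf E + b).
  by exists x; split => // z Yz Fz; have := infle z Yz Fz; lra.
have [_ [y [Yy Fy] <-] ylt] := inf_adherent b0 (conj En0 Enb).
exists y; split => //; first exact: ltW (lt_trans ylt xgt).
by move=> z Yz Fz; have := infle z Yz Fz; lra.
Qed.

(** Stage j adds a multiple of the gauge centred at the current point v j. Its mass
    is tau j - tau (j + 1), so that tau j is the mass still to be spent and bounds
    the Lipschitz constant of all later perturbations; its precision
    kappa / 2 ^ j makes the total error at most kappa * tau 0. *)
Section Perturbed.
Variables (tau : nat -> R) (Theta : R -> X -> X -> R) (kappa : R).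
Hypothesis tau_dec : forall i, tau i.+1 < tau i.
Hypothesis kappa_gt0 : 0 < kappa.
Hypothesis Theta_lip : forall e x x' y, 0 < e ->
  Theta e x y <= Theta e x' y + mdist x x'.
Hypothesis Theta_ge : forall e x y, 0 < e -> mdist x y - e <= Theta e x y.
Hypothesis Theta_diag : forall e y, 0 < e -> Theta e y y <= 0.

Let wt i := tau i - tau i.+1.
Let prec i : R := kappa * 2^-1 ^+ i.

Let wt_gt0 i : 0 < wt i. Proof. by rewrite subr_gt0. Qed.
Let prec_gt0 i : 0 < prec i. Proof. by rewrite mulr_gt0// exprn_gt0// invr_gt0. Qed.
Let prec_le i : prec i <= kappa.
Proof.
rewrite ler_piMr//; first exact: ltW.
by rewrite exprn_ile1// ?invr_ge0// invf_le1// ler1n.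
Qed.

Definition perturbation (v : nat -> X) i x :=
  \sum_(j < i) (tau j - tau j.+1) * Theta (kappa * 2^-1 ^+ j) x (v j).

Lemma perturbation0 v x : perturbation v 0 x = 0.
Proof. exact: big_ord0. Qed.

Lemma perturbationS v i x : perturbation v i.+1 x =
  perturbation v i x + (tau i - tau i.+1) * Theta (kappa * 2^-1 ^+ i) x (v i).
Proof. exact: big_ord_recr. Qed.

Lemma tail_le i j : (i <= j)%N -> tau j <= tau i.
Proof.
by elim: j => [|j IH]; [rewrite leqn0 => /eqP->|
  rewrite leq_eqVlt ltnS => /orP[/eqP->//|/IH]; apply: le_trans; exact: ltW].
Qed.

Lemma perturbation_lip v i j x y : (i <= j)%N ->
  perturbation v j x - perturbation v i x <=
  perturbation v j y - perturbation v i y + (tau i - tau j) * mdist x y.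
Proof.
elim: j => [|j IH]; first by rewrite leqn0 => /eqP->; lra.
rewrite leq_eqVlt ltnS => /orP[/eqP->|/IH {}IH]; first by lra.
rewrite !perturbationS.
have : wt j * Theta (prec j) x (v j) <=
  wt j * (Theta (prec j) y (v j) + mdist x y).
  by apply: ler_wpM2l; [exact: ltW|exact: Theta_lip].
rewrite /wt /prec; lra.
Qed.

Lemma perturbation_ge v i x :
  - (kappa * (tau 0%N - tau i)) <= perturbation v i x.
Proof.
elim: i => [|i IH]; first by rewrite perturbation0; lra.
rewrite perturbationS.
have : wt i * - kappa <= wt i * Theta (prec i) x (v i).
  apply: ler_wpM2l; first exact: ltW.
  by have := Theta_ge x (v i) (prec_gt0 i); have := prec_le i;
    have := mdist_ge0 x (v i); lra.
rewrite /wt /prec; lra.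
Qed.

Lemma perturbation_first v i x : - (kappa * tau 0%N - kappa * tau i.+1)
  + (tau 0%N - tau 1%N) * mdist x (v 0%N) <= perturbation v i.+1 x.
Proof.
elim: i => [|i IH].
  rewrite perturbationS perturbation0 add0r.
  have : wt 0 * (mdist x (v 0%N) - prec 0) <= wt 0 * Theta (prec 0) x (v 0%N).
    by apply: ler_wpM2l; [exact: ltW|exact: Theta_ge].
  rewrite /wt /prec expr0; lra.
rewrite perturbationS.
have : wt i.+1 * - kappa <= wt i.+1 * Theta (prec i.+1) x (v i.+1).
  apply: ler_wpM2l; first exact: ltW.
  by have := Theta_ge x (v i.+1) (prec_gt0 i.+1); have := prec_le i.+1;
    have := mdist_ge0 x (v i.+1); lra.
rewrite /wt /prec; lra.
Qed.

(** The point v (i + 1) almost minimizes the function perturbed i + 1 times, and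
    its perturbed value does not exceed that of v i. The first fact, compared with the
    previous stage, forces d(v (i + 1), v i) to decay geometrically. In the limit x,
    the inequality at index i only involves the first i gauges: this lets later
    arguments differentiate a finite sum and treat the tail as a Lipschitz error.
    Because the perturbed values decrease, the bound on F x + sigma * d(x, x0) has
    no loss except kappa * tau 0. *)
Lemma variational_principle F (Y : set X) x0 (a m : R) :
  complete_space X -> closed Y -> lower_semicontinuous F ->
  (forall x, 0 <= F x)%E -> (forall i, 0 < tau i) ->
  Y x0 -> F x0 = a%:E -> a + kappa * tau 0%N <= m ->
  exists v : nat -> X, exists x, [/\ Y x,
    (F x + ((tau 0%N - tau 1%N) * mdist x x0)%:E <= m%:E)%E &
    forall i y, Y y ->
      (F x + (perturbation v i x)%:E <=
       F y + (perturbation v i y + tau i * mdist y x)%:E)%E].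
Proof.
move=> cX clY Flsc F0 tau0 Yx0 Fx0 am.
pose P (q : nat * (X -> R) * X) y := [/\ Y y, F y \is a fin_num,
  fine (F y) + q.1.2 y <= fine (F q.2) + q.1.2 q.2
  & forall z, Y z -> F z \is a fin_num ->
        fine (F y) + q.1.2 y <= fine (F z) + q.1.2 z + wt q.1.1 * 2^-1 ^+ q.1.1].
have [pick pickP] : exists pick : nat * (X -> R) * X -> X, forall q,
  Y q.2 -> F q.2 \is a fin_num -> (exists B, forall y, - B <= q.1.2 y) ->
  P q (pick q).
  suff /choice[pick ?] : forall q, exists y, Y q.2 -> F q.2 \is a fin_num ->
    (exists B, forall y, - B <= q.1.2 y) -> P q y by exists pick.
  move=> -[[i Phi] z] /=.
  have [[Yz [Fz [B PhiB]]]|nP] := pselect (Y z /\ F z \is a fin_num /\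
      exists B, forall y, - B <= Phi y).
    have w0 : 0 < wt i * 2^-1 ^+ i by rewrite mulr_gt0// exprn_gt0// invr_gt0.
    have [y Hy] := near_minimizer F0 PhiB w0 Yz Fz.
    by exists y => _ _ _.
  by exists z => Yz Fz HB; case: nP.
pose step (i : nat) (s : X * (X -> R)) : X * (X -> R) :=
  let Phi x := s.2 x + wt i * Theta (prec i) x s.1 in
  (pick (i.+1, Phi, s.1), Phi).
pose st := nat_rect (fun=> (X * (X -> R))%type) (x0, fun=> 0) step.
pose v i := (st i).1.
have stE i : (st i).2 = perturbation v i.
  elim: i => [|i IH]; apply/funext => x; first by rewrite perturbation0.
  by rewrite perturbationS -IH.
have vE i : v i.+1 = pick (i.+1, perturbation v i.+1, v i).
  by rewrite -stE.
have PB i : exists B, forall y, - B <= perturbation v i y.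
  by eexists => y; exact: perturbation_ge.
have Yv i : Y (v i) /\ F (v i) \is a fin_num.
  elim: i => [|i [Yi Fi]]; first by rewrite /v /= Fx0.
  by rewrite vE; have [] := pickP (i.+1, perturbation v i.+1, v i) Yi Fi (PB _).
have vP i : P (i.+1, perturbation v i.+1, v i) (v i.+1).
  by rewrite [X in P _ X]vE; apply: pickP; [exact: (Yv i).1|exact: (Yv i).2|exact: PB].
have vmin i z : Y z -> F z \is a fin_num ->
    fine (F (v i.+1)) + perturbation v i.+1 (v i.+1) <=
    fine (F z) + perturbation v i.+1 z + wt i.+1 * 2^-1 ^+ i.+1.
  by move=> Yz Fz; have [_ _ _] := vP i; exact.
have vdec i : fine (F (v i.+1)) + perturbation v i.+1 (v i.+1)
    <= fine (F (v i)) + perturbation v i (v i).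
  have [_ _ /= h _] := vP i; apply: le_trans h _.
  rewrite [X in _ + X <= _]perturbationS.
  have : wt i * Theta (prec i) (v i) (v i) <= 0.
    by rewrite pmulr_rle0// Theta_diag.
  rewrite /wt /prec; lra.
have va i : fine (F (v i)) + perturbation v i (v i) <= a.
  elim: i => [|i IH]; last exact: le_trans (vdec i) IH.
  by rewrite perturbation0 /v /= Fx0 addr0.
have vdist i : mdist (v i.+2) (v i.+1) <= (kappa + 1) * 2^-1 ^+ i.
  have h1 := vmin i _ (Yv i.+2).1 (Yv i.+2).2; have h2 := vdec i.+1.
  move: h2; rewrite perturbationS => h2.
  have : wt i.+1 * Theta (prec i.+1) (v i.+2) (v i.+1) <= wt i.+1 * 2^-1 ^+ i.+1.
    by move: h1 h2; rewrite /wt /prec; lra.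
  rewrite ler_pM2l// => h3.
  have := Theta_ge (v i.+2) (v i.+1) (prec_gt0 i.+1).
  have : 0 <= (kappa + 1) * 2^-1 ^+ i.
    by rewrite mulr_ge0 ?exprn_ge0 ?invr_ge0// ltW// addr_gt0.
  move: h3; rewrite /prec exprS; lra.
have [x vx'] := geometric_cvg cX vdist.
have vx : v @ \oo --> x by move=> A /vx'[N _ HN]; exists N.+1 => // -[|n]//= /HN.
have Yx : Y x.
  apply: (@closed_cvg _ _ \oo _ v Y clY _ x vx); apply: nearW => i.
  exact: (Yv i).1.
have dv e : 0 < e -> \forall i \near \oo, mdist x (v i) < e.
  by move=> e0; exact: (metricType_numDomainType.cvgr_dist_lt vx).
have finE i : F (v i) = (fine (F (v i)))%:E by rewrite fineK// (Yv i).2.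
exists v, x; split => //.
  have : (F x <= (m - (tau 0%N - tau 1%N) * mdist x x0)%:E)%E.
    apply: (lsc_le Flsc vx) => e e0.
    have e1 : 0 < e / wt 0 by exact: divr_gt0.
    near=> i; rewrite finE lee_fin.
    have i1 : (0 < i)%N by near: i; exact: nbhs_infty_gt.
    have : wt 0 * mdist x (v i) <= e.
      by rewrite mulrC -ler_pdivlMr// ltW//; near: i; exact: dv.
    have : wt 0 * mdist x x0 <= wt 0 * (mdist x (v i) + mdist (v i) x0).
      by apply: ler_wpM2l; [exact: ltW|exact: metric_triangle].
    have := va i; rewrite -(prednK i1).
    have := perturbation_first v i.-1 (v i.-1.+1).
    have := mulr_gt0 kappa_gt0 (tau0 i.-1.+1).
    rewrite /wt [v 0%N]/v /=; lra.
  move/leeD2r => /(_ ((tau 0%N - tau 1%N) * mdist x x0)%:E).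
  by rewrite -EFinD subrK.
move=> i y Yy; have [->|Fy] := eqVneq (F y) +oo%E; first by rewrite leey.
have Fyfin : F y \is a fin_num by rewrite ge0_fin_numE// lt_neqAle Fy leey.
rewrite -(fineK Fyfin); set b := fine _.
suff : (F x <= (b + (perturbation v i y + tau i * mdist y x) - perturbation v i x)%:E)%E.
  move/leeD2r => /(_ (perturbation v i x)%:E).
  by rewrite -EFinD subrK.
apply: (lsc_le Flsc vx) => e e0.
pose T := tau i + (tau 0%N - tau i).
have T0 : 0 < T by rewrite /T addrC subrK.
have e1 : 0 < e / 2 / T by rewrite !divr_gt0.
have e2 : 0 < e / 2 by rewrite divr_gt0.
near=> j; rewrite finE lee_fin.
have i1 : (0 < j)%N by near: j; exact: nbhs_infty_gt.
have ij : (i <= j)%N by near: j; exact: nbhs_infty_ge.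
have : T * mdist x (v j) < e / 2 by rewrite mulrC -ltr_pdivlMr//; near: j; exact: dv.
have := vmin j.-1 y Yy Fyfin; rewrite prednK//.
have := perturbation_lip v y (v j) ij.
have := perturbation_lip v x (v j) (leq0n i).
rewrite !perturbation0.
have : (tau i - tau j) * mdist y (v j) <= tau i * mdist y (v j).
  by apply: ler_wpM2r; [exact: mdist_ge0|rewrite lerBlDr lerDl ltW].
have : tau i * mdist y (v j) <= tau i * (mdist y x + mdist x (v j)).
  by apply: ler_wpM2l; [exact: ltW|exact: metric_triangle].
have : wt j * 2^-1 ^+ j <= e / 2.
  apply: (@le_trans _ _ (tau 0%N * 2^-1 ^+ j)).
    apply: ler_wpM2r; first by rewrite exprn_ge0// invr_ge0.
    by rewrite /wt; have := tail_le (leq0n j); have := tau0 j.+1; lra.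
  by apply: ltW; near: j; exact: half_expn_small.
rewrite /T /b; lra.
Unshelve. all: by end_near. Qed.

End Perturbed.
End Variational.

(** * Ekeland's principle and metric slopes *)

Section Ekeland.
Context {R : realType} {X : metricType R}.
Implicit Types (f F : X -> \bar R).

(** The first gauge gets mass sigma, which controls the distance to x0; the
    remaining c - sigma is spent along a geometric progression. *)
Definition geometric_tail (c sigma : R) (i : nat) : R :=
  if i is j.+1 then (c - sigma) * 2^-1 ^+ j else c.

Lemma geometric_tail_gt0 c sigma i : 0 < sigma < c -> 0 < geometric_tail c sigma i.
Proof.
move=> /andP[s0 sc]; case: i => [|i] /=; first exact: lt_trans sc.
by rewrite mulr_gt0 ?subr_gt0// exprn_gt0// invr_gt0.
Qed.

Lemma geometric_tail_dec c sigma i : 0 < sigma < c ->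
  geometric_tail c sigma i.+1 < geometric_tail c sigma i.
Proof.
move=> sc; case: i => [|i]; first by rewrite /= expr0; lra.
by have := @geometric_tail_gt0 _ _ i.+1 sc; rewrite /= exprS; lra.
Qed.

Lemma lsc_maxe0 f : lower_semicontinuous f ->
  lower_semicontinuous (fun x => maxe (f x) 0%E).
Proof.
move=> fl x a; rewrite lt_max => /orP[/fl[U xU Ua]|a0].
  by exists U => // y /Ua aU; rewrite lt_max aU.
by exists setT; [exact: filterT|move=> y _; rewrite lt_max a0 orbT].
Qed.

Lemma ekeland F x0 (sigma c a m : R) : complete_space X ->
  lower_semicontinuous F -> (forall x, 0 <= F x)%E -> 0 < sigma < c ->
  F x0 = a%:E -> a < m ->
  exists2 u, (F u + (sigma * mdist u x0)%:E <= m%:E)%E &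
    forall y, (F u <= F y + (c * mdist y u)%:E)%E.
Proof.
move=> cX Fl F0 sc Fx0 am.
have c0 : 0 < c by lra.
have k0 : 0 < (m - a) / c by rewrite divr_gt0// subr_gt0.
have [|||||v [u [_ h1 h2]]] := @variational_principle R X (geometric_tail c sigma)
  (fun _ => mdist) _ (fun i => geometric_tail_dec i sc) k0
  _ _ _ F setT x0 a m cX (@closedT _) Fl F0
  (fun i => geometric_tail_gt0 i sc) _ Fx0.
- by move=> _ x x' y _; rewrite addrC; exact: metric_triangle.
- by move=> e x y e0; rewrite gerBl ltW.
- by move=> e y _; rewrite mdistxx.
- by [].
- by rewrite /= divfK ?gt_eqF//; lra.
exists u.
  by move: h1; rewrite /= expr0 mulr1 opprB [X in (X * _)%:E]addrC subrK.
by move=> y; have := h2 0%N y Logic.I; rewrite !perturbation0 adde0 add0r.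
Qed.

End Ekeland.

Lemma leeB_of_leeD (R : realType) (b c : R) (y : \bar R) : y != -oo%E ->
  (b%:E <= y + c%:E -> b%:E - y <= c%:E)%E.
Proof.
case: y => [y _| |//]; last by rewrite addeNy leNye.
by rewrite -EFinD -EFinB !lee_fin; lra.
Qed.

(** Everything that the error bound criterion requires from a slope operator. *)
Definition ekeland_property (R : realType) (X : metricType R)
    (s : (X -> \bar R) -> X -> \bar R) :=
  forall f x0 (sigma c a m : R), complete_space X -> never_ninfty f ->
  lower_semicontinuous f -> 0 < sigma < c -> 0 <= a -> f x0 = a%:E -> a < m ->
  exists2 u, (maxe (f u) 0 + (sigma * mdist u x0)%:E <= m%:E)%E &
    (0 < f u -> s f u <= c%:E)%E.

Section Slopes.
Context {R : realType} {X : metricType R}.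
Implicit Types (f : X -> \bar R).

(** Ekeland's principle is applied to max(f, 0), which is bounded below; where f is
    positive its value is that of f. *)
Lemma ekeland_positive f x0 (sigma c a m : R) : complete_space X ->
  lower_semicontinuous f -> 0 < sigma < c -> 0 <= a ->
  f x0 = a%:E -> a < m ->
  exists2 u, (maxe (f u) 0 + (sigma * mdist u x0)%:E <= m%:E)%E &
    (0 < f u)%E -> exists2 b : R, f u = b%:E &
      forall y, (b%:E <= maxe (f y) 0 + (c * mdist y u)%:E)%E.
Proof.
move=> cX fl sc a0 fa am.
have F0 x : (0 <= maxe (f x) 0)%E by rewrite le_max lexx orbT.
have Fx0 : (maxe (f x0) 0)%E = a%:E by rewrite fa; apply/max_idPl; rewrite lee_fin.
have [u h1 h2] := ekeland cX (lsc_maxe0 fl) F0 sc Fx0 am.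
exists u => // fu0.
have fufin : f u \is a fin_num.
  move: h1 fu0; case: (f u) => [//| |//]; rewrite max_l ?leey//.
exists (fine (f u)); first by rewrite fineK.
by move=> y; move: (h2 y); rewrite [X in (X <= _)%E](max_idPl (ltW fu0)) fineK.
Qed.

Lemma ekeland_nonlocal_slope : @ekeland_property R X nonlocal_slope.
Proof.
move=> f x0 sigma c a m cX _ fl sc a0 fa am.
have [u um ub] := ekeland_positive cX fl sc a0 fa am.
have c0 : 0 <= c by lra.
exists u => // /ub[b fu fb]; rewrite /nonlocal_slope fu /=.
rewrite ge_max lee_fin c0 /=; apply: ge_ereal_sup => _ [y /= yu <-].
have d0 : 0 < mdist y u by rewrite mdist_gt0.
rewrite inver gt_eqF// lee_pdivrMr// ge_max -EFinM lee_fin mulr_ge0 ?mdist_ge0//=.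
by apply: leeB_of_leeD => //; rewrite -ltNye lt_max ltNy0 orbT.
Qed.

Lemma ekeland_slope : @ekeland_property R X slope.
Proof.
move=> f x0 sigma c a m cX _ fl sc a0 fa am.
have [u um ub] := ekeland_positive cX fl sc a0 fa am.
have c0 : 0 <= c by lra.
exists u => // fu0; have [b fu fb] := ub fu0; rewrite /slope fu /=.
rewrite ge_max lee_fin c0 /=.
have [U uU Uf] := fl _ _ fu0.
rewrite limf_esupE; apply: ge_ereal_inf; eexists.
  exists (U `&` [set y | y != u]); last reflexivity.
  by rewrite /dnbhs /within /=; apply: filterS uU => y Uy yu; split.
apply: ge_ereal_sup => _ [y [/Uf fy0 /= yu] <-].
have d0 : 0 < mdist y u by rewrite mdist_gt0.
rewrite inver gt_eqF// lee_pdivrMr// ge_max -EFinM lee_fin mulr_ge0 ?mdist_ge0//=.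
have := fb y; rewrite (max_idPl (ltW fy0)) => fb'.
by apply: leeB_of_leeD => //; rewrite -ltNye (lt_trans ltNy0 fy0).
Qed.

End Slopes.

(** * The Clarke slope *)

Section Clarke.
Context {R : realType} {V : normedModType R}.
Implicit Types (f : V -> \bar R) (x z w : V).

(** An epsilon-delta form of f^0(x; z) <= r, free of limits. It is implied by
    f^0(x; z) < r, and it is stable under sums and positive multiples, which makes
    the pairs (z, r) a cone. *)
Definition clarke_bound f x z (r : R) := forall e, 0 < e -> exists2 eta, 0 < eta &
  forall u a t, `|u - x| < eta -> `|a - fine (f x)| < eta -> (f u <= a%:E)%E ->
    0 < t -> t < eta ->
    exists2 z', `|z' - z| < e & (f (u + t *: z')%R <= (a + t * r)%:E)%E.

(** The inner upper limit decreases when e grows, so the limit as e tends to 0+ is a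
    supremum. *)
Lemma clarke_ddE f x z : clarke_dd f x z = ereal_sup
  [set limf_esup
    (fun p : V * R * R =>
      ereal_inf [set (f (p.1.1 + p.2 *: z')%R - p.1.2%:E) / p.2%:E |
                 z' in [set z' | (`|z' - z| < e)%R]])%E (clarke_filter f x)
    | e in [set e : R | 0 < e]].
Proof.
rewrite /clarke_dd; apply/cvg_lim => //.
set g := (X in X @ _ --> _).
have -> : [set e : R | 0 < e] = [set` Interval (BRight (0 : R)) +oo%O].
  by apply/seteqP; split => e /=; rewrite in_itv /= andbT.
apply: (@nonincreasing_at_right_cvge R g 0 +oo%O) => // e e' _ _ ee'.
rewrite /g !limf_esupE; apply: le_ereal_inf_tmp => _ [W FW <-].
apply: ge_ereal_inf; eexists; first by exists W.
apply: ge_ereal_sup => _ [p Wp <-]; apply: le_ereal_sup_tmp.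
eexists; first by exists p.
apply: ereal_inf_le_tmp => _ [z' /= zz' <-]; exists z' => //.
exact: lt_le_trans ee'.
Qed.

Lemma clarke_dd_lt f x z (r : R) : (clarke_dd f x z < r%:E)%E ->
  clarke_bound f x z r.
Proof.
move=> fr e e0.
have : (limf_esup
    (fun p : V * R * R =>
      ereal_inf [set (f (p.1.1 + p.2 *: z')%R - p.1.2%:E) / p.2%:E |
                 z' in [set z' | (`|z' - z| < e)%R]])%E (clarke_filter f x) < r%:E)%E.
  apply: le_lt_trans fr; rewrite clarke_ddE; apply: le_ereal_sup_tmp.
  by eexists; first by exists e.
rewrite limf_esupE => /ereal_inf_lt[_ [W FW <-] Wr].
have [[A B] [/= FA FB] ABW] := FW.
have [[A1 A2] [/= A1x A2f] A12] := FA.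
have [e1 /= e10 e1A] := (nbhs_ballP _ _).1 A1x.
have [e2 /= e20 e2A] := (nbhs_ballP _ _).1 A2f.
have [e3 /= e30 e3B] := FB.
exists (Num.min e1 (Num.min e2 e3)); first by rewrite !lt_min e10 e20.
move=> u a t; rewrite !lt_min => /and3P[ux _ _] /and3P[_ ax _] fua t0 /and3P[_ _ te].
have Wp : W (u, a, t).
  apply: ABW; split => /=; last first.
    by apply: e3B => //=; rewrite sub0r normrN gtr0_norm.
  apply: (A12 (u, a)) => //; split => /=.
    by apply: e1A; rewrite -ball_normE /= distrC.
  by apply: e2A; rewrite -ball_normE /= distrC.
have : (ereal_inf [set (f (u + t *: z')%R - a%:E) / t%:E |
    z' in [set z' | (`|z' - z| < e)%R]] < r%:E)%E.
  by apply: le_lt_trans Wr; apply: le_ereal_sup_tmp; eexists; first by exists (u, a, t).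
move=> /ereal_inf_lt[_ [z' /= z'z <-]].
rewrite inver gt_eqF// => fr'; exists z' => //.
move: fr'; rewrite lte_pdivrMr// => /ltW.
by rewrite EFinN leeBlDl// -EFinM -EFinD mulrC.
Qed.

(** Rockafellar's argument: apply the bound for z from (u, a), and then the bound for
    w from the point (u + t z', a + t r), which belongs to the epigraph and is still
    close to (x, f x). *)
Lemma clarke_boundD f x z w (r s : R) :
  clarke_bound f x z r -> clarke_bound f x w s -> clarke_bound f x (z + w) (r + s).
Proof.
move=> fz fw e e0; have e2 : 0 < e / 2 by lra.
have [e1 e10 H1] := fz _ e2; have [e3 e30 H3] := fw _ e2.
(* C bounds the norm of z' and |r|, hence t * C bounds how far the point
   (u + t z', a + t r) is from (u, a) *)
have [C CE] : exists C, C = 1 + `|z| + e + `|r| by eexists.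
have C0 : 0 < C by have := normr_ge0 z; have := normr_ge0 r; rewrite CE; lra.
have e4 : 0 < e3 / (1 + C) by rewrite divr_gt0// addr_gt0.
exists (Num.min e1 (e3 / (1 + C))); first by rewrite lt_min e10.
move=> u a t; rewrite !lt_min => /andP[ux1 ux2] /andP[a1 a2] fua t0 /andP[t1 t2].
have [z' zz' fz'] := H1 u a t ux1 a1 fua t0 t1.
have step b : b < e3 / (1 + C) -> b + e3 / (1 + C) * C <= e3.
  move=> be; have : e3 / (1 + C) * (1 + C) = e3 by rewrite divfK// gt_eqF// addr_gt0.
  lra.
have tC' : t * C < e3 / (1 + C) * C by rewrite ltr_pM2r.
have [|||w' ww' fw'] := H3 (u + t *: z') (a + t * r) t _ _ fz' t0 _.
- rewrite addrAC; apply: le_lt_trans (ler_normD _ _) _.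
  rewrite normrZ gtr0_norm//.
  have z'C : t * `|z'| <= t * C.
    apply: ler_wpM2l; first exact: ltW.
    rewrite -[z'](subrK z); apply: le_trans (ler_normD _ _) _.
    by rewrite CE; have := normr_ge0 r; lra.
  by apply: lt_le_trans (step _ ux2); have := le_lt_trans z'C tC'; lra.
- rewrite addrAC; apply: le_lt_trans (ler_normD _ _) _.
  rewrite normrM gtr0_norm//.
  have rC : t * `|r| <= t * C.
    apply: ler_wpM2l; first exact: ltW.
    by rewrite CE; have := normr_ge0 z; lra.
  by apply: lt_le_trans (step _ a2); have := le_lt_trans rC tC'; lra.
- apply: lt_le_trans t2 _; rewrite ler_pdivrMr ?addr_gt0//.
  by have := mulr_gt0 e30 C0; lra.
exists (z' + w'); last by rewrite scalerDr addrA mulrDr addrA.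
rewrite opprD addrACA; apply: le_lt_trans (ler_normD _ _) _; lra.
Qed.

Lemma clarke_boundZ f x z (r s : R) : 0 < s ->
  clarke_bound f x z r -> clarke_bound f x (s *: z) (s * r).
Proof.
move=> s0 fz e e0; have es : 0 < e / s by rewrite divr_gt0.
have [e1 e10 H1] := fz _ es.
exists (Num.min e1 (e1 / s)); first by rewrite lt_min e10 divr_gt0.
move=> u a t; rewrite !lt_min => /andP[ux1 _] /andP[a1 _] fua t0 /andP[_ t2].
have [||z' zz' fz'] := H1 u a (t * s) ux1 a1 fua.
- by rewrite mulr_gt0.
- by rewrite -ltr_pdivlMr.
exists (s *: z'); last by rewrite scalerA mulrA.
by rewrite -scalerBr normrZ gtr0_norm// mulrC -ltr_pdivlMr.
Qed.

(** At a local minimum of f + c * |. - x| the difference quotients taken at the base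
    point (x, f x) itself are at least - c * |z'|. *)
Lemma clarke_bound_ge f x (a c d : R) z r : 0 <= c -> 0 < d -> f x = a%:E ->
  (forall y, `|y - x| < d -> (a%:E <= f y + (c * `|y - x|)%:E)%E) ->
  clarke_bound f x z r -> - (c * `|z|) <= r.
Proof.
move=> c0 d0 fx fmin fz; rewrite lerNl; apply/ler_addgt0Pr => e e0.
have c1 : 0 < c + 1 by lra.
have e1 : 0 < e / (c + 1) by rewrite divr_gt0.
have [eta eta0 H] := fz _ e1.
have [D DE] : exists D, D = `|z| + e / (c + 1) by eexists.
have D0 : 0 < D by rewrite DE ltr_wpDl.
have [t [t0 te tD]] : exists t, [/\ 0 < t, t < eta & t * D < d].
  exists (Num.min (eta / 2) (d / (D + 1))); split.
  - by rewrite lt_min !divr_gt0// addr_gt0.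
  - by rewrite gt_min; apply/orP; left; lra.
  - apply: (@le_lt_trans _ _ (d / (D + 1) * D)).
      by apply: ler_wpM2r; [exact: ltW|rewrite ge_min lexx orbT].
    by rewrite mulrAC ltr_pdivrMr ?addr_gt0// ltr_pM2l//; lra.
have [|||z' zz' fz'] := H x a t _ _ _ t0 te.
- by rewrite subrr normr0.
- by rewrite fx /= subrr normr0.
- by rewrite fx.
have z'D : `|z'| <= D.
  by rewrite -[z'](subrK z); apply: le_trans (ler_normD _ _) _; rewrite DE; lra.
have tz' : `|x + t *: z' - x| = t * `|z'|.
  by rewrite addrAC subrr add0r normrZ gtr0_norm.
have : (a%:E <= (a + t * r + c * (t * `|z'|))%:E)%E.
  have := fmin (x + t *: z'); rewrite tz' => h; apply: le_trans (h _) _.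
    by apply: le_lt_trans tD; rewrite ler_wpM2l// ltW.
  by rewrite EFinD leeD2r.
rewrite lee_fin => h1.
have h2 : 0 <= t * (r + c * `|z'|) by lra.
move: h2; rewrite pmulr_rge0// => h2.
have h3 : c * `|z'| <= c * D by apply: ler_wpM2l.
have h4 : c * (e / (c + 1)) <= e.
  by rewrite mulrA ler_pdivrMr//; lra.
move: h3 h4; rewrite DE; lra.
Qed.

Lemma clarke_subgradient f x (a c d : R) : 0 <= c -> 0 < d -> f x = a%:E ->
  (forall y, `|y - x| < d -> (a%:E <= f y + (c * `|y - x|)%:E)%E) ->
  exists2 p, dual_ball c p & clarke_subdiff f x p.
Proof.
move=> c0 d0 fx fmin.
have [|||p pc pK] := @sandwich R V c [set k | clarke_bound f x k.1 k.2] c0.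
- by move=> k l; exact: clarke_boundD.
- by move=> t k t0; exact: clarke_boundZ.
- by move=> k; exact: clarke_bound_ge fmin.
exists p => //; split; first by rewrite fx ltry.
  exact: dual_ball_continuous pc.
move=> z; rewrite leNgt; apply/negP => lt_dd.
have [r rp ltr] : exists2 r, r < p z & (clarke_dd f x z < r%:E)%E.
  move: lt_dd; case: (clarke_dd f x z) => [b| |]; rewrite ?lte_fin//.
    by move=> bp; exists ((b + p z) / 2); rewrite ?lte_fin; lra.
  by move=> _; exists (p z - 1); [lra|exact: ltNyr].
by have := pK (z, r) (clarke_dd_lt ltr); rewrite leNgt rp.
Qed.

Lemma subdiff_slope_le (S : set {linear V -> R^o}) c p : 0 <= c ->
  dual_ball c p -> S p -> (subdiff_slope S <= c%:E)%E.
Proof.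
move=> c0 pc Sp; apply: ge_ereal_inf; exists (functional_norm setT p); first by exists p.
apply: ge_ereal_sup => _ [z [_ z1] <-]; rewrite lee_fin.
by apply: le_trans (pc z) _; rewrite ler_piMr.
Qed.

End Clarke.

Lemma ekeland_clarke_slope (R : realType) (V : completeNormedModType R) :
  @ekeland_property R (normed_metric V) (@clarke_slope R V).
Proof.
move=> f x0 sigma c a m cX _ fl sc a0 fa am.
have [u um ub] := ekeland_positive cX fl sc a0 fa am.
have c0 : 0 <= c by lra.
exists u => // fu0; have [b fu fb] := ub fu0.
have [U uU Uf] := fl _ _ fu0.
have [d /= d0 dU] := (@nbhs_ballP R V u U).1 uU.
have [|p pc pS] := @clarke_subgradient R V f u b c d c0 d0 fu.
  move=> y yu; have := fb y; rewrite (max_idPl _) //; apply/ltW/Uf/dU.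
  by rewrite -ball_normE /= distrC.
exact: subdiff_slope_le pS.
Qed.

(** * A smooth approximation of the norm on separable subspaces *)

Section WeakStarLimits.
Context {R : realType} {V : normedModType R}.
Implicit Types (p : {linear V -> R^o}) (U : set_system {linear V -> R^o}).

Lemma ultra_bounded_lim (T : Type) (U : set_system T) (g : T -> R) (C : R) :
  UltraFilter U -> U [set t | `|g t| <= C] ->
  exists l, forall e, 0 < e -> U [set t | `|g t - l| < e].
Proof.
move=> UU gC.
have FC : (g @ U) `[- C, C]%classic.
  change (U [set t | `[- C, C]%classic (g t)]); apply: filterS gC => t /=.
  by rewrite in_itv /= -ler_norml.
have [l [_ cl]] := @segment_compact _ (- C) C (g @ U) _ FC.
exists l => e e0; have [//|Uc] := in_ultra_setVsetC [set t | `|g t - l| < e] UU.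
have [] := cl [set y | e <= `|y - l|] (ball l e).
- change (U [set t | e <= `|g t - l|]).
  by apply: filterS Uc => t /= /negP; rewrite -leNgt.
- exact: nbhsx_ballx.
- move=> y [/= ey]; rewrite -ball_normE /= distrC => /lt_le_trans/(_ ey).
  by rewrite ltxx.
Qed.

(** The Banach-Alaoglu theorem: the limit along an ultrafilter is taken pointwise,
    in the compact intervals [- c |x|, c |x|]. *)
Lemma weakstar_limit U c : UltraFilter U -> U (dual_ball c) ->
  exists2 p, dual_ball c p & forall x e, 0 < e -> U [set q | `|q x - p x| < e].
Proof.
move=> UU Uc.
have /choice[g gP] : forall x : V, exists l : R, forall e, 0 < e ->
    U [set q : {linear V -> R^o} | `|q x - l| < e].
  move=> x; apply: (@ultra_bounded_lim _ U (fun q => q x) (c * `|x|)) => //.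
  by apply: filterS Uc => q; exact.
have gl : linear (g : V -> R^o).
  move=> t x y; change (g (t *: x + y) = t * g x + g y).
  apply/eqP; rewrite -subr_eq0 -normr_le0; apply/ler_addgt0Pr => e e0.
  have e1 : 0 < e / (`|t| + 2) by rewrite divr_gt0// ltr_wpDl.
  have [q [[/= h1 h2] h3]] := filter_ex (filterI (filterI (gP x _ e1) (gP y _ e1))
    (gP (t *: x + y) _ e1)).
  have {}h3 : `|t * q x + q y - g (t *: x + y)| < e / (`|t| + 2).
    by move: h3; rewrite /= linearP.
  have -> : g (t *: x + y) - (t * g x + g y) =
    t * (q x - g x) + (q y - g y) - (t * q x + q y - g (t *: x + y)) by ring.
  apply: le_trans (ler_normB _ _) _; apply: le_trans (lerD (ler_normD _ _) (lexx _)) _.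
  rewrite normrM.
  have : `|t| * `|q x - g x| <= `|t| * (e / (`|t| + 2)).
    by apply: ler_wpM2l => //; exact: ltW.
  have : e / (`|t| + 2) * (`|t| + 2) = e by rewrite divfK// gt_eqF// ltr_wpDl.
  lra.
have [p pg] := linear_of_fun gl.
exists p => [x|x e e0]; last by rewrite pg; exact: gP.
rewrite pg; apply/ler_addgt0Pr => e e0.
have [q [qc /= qe]] := filter_ex (filterI Uc (gP x _ e0)).
have -> : g x = q x - (q x - g x) by ring.
by apply: le_trans (ler_normB _ _) _; apply: lerD; [exact: qc|exact: ltW].
Qed.

End WeakStarLimits.

(** The penalty of p is a weighted sum of strictly convex functions of the values
    sup p over given subsets A n of the unit ball. These values are weak-star lower
    semicontinuous, whatever the sets are; the choice of A n decides how much the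
    penalty controls. *)
Section SmoothNorm.
Context {R : realType} {V : normedModType R}.
Implicit Types (p q : {linear V -> R^o}).
Variable A : nat -> set V.
Hypothesis A0 : forall n, A n !=set0.
Hypothesis A1 : forall n z, A n z -> `|z| <= 1.

Definition support_fun n p : R := sup [set p z | z in A n].

Lemma support_fun_ge n p z : dual_ball 1 p -> A n z -> p z <= support_fun n p.
Proof.
move=> p1 Az; apply: ub_le_sup; last by exists z.
exists 1 => _ [y Ay <-]; apply: le_trans (ler_norm _) _.
by apply: le_trans (p1 y) _; rewrite mul1r; exact: A1 Ay.
Qed.

Lemma support_fun_le n p c : (forall z, A n z -> p z <= c) -> support_fun n p <= c.
Proof.
move=> pc; apply: ge_sup => [|_ [z Az <-]]; last exact: pc.
by have [z Az] := A0 n; exists (p z); exists z.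
Qed.

Lemma dual_ball1_le p z : dual_ball 1 p -> `|z| <= 1 -> - 1 <= p z <= 1.
Proof.
by move=> p1 z1; have := p1 z; rewrite mul1r => /le_trans/(_ z1); rewrite ler_norml.
Qed.

Lemma support_fun_bound n p : dual_ball 1 p -> - 1 <= support_fun n p <= 1.
Proof.
move=> p1; apply/andP; split.
  have [z Az] := A0 n; have /andP[h _] := dual_ball1_le p1 (A1 Az).
  by apply: le_trans h _; exact: support_fun_ge.
by apply: support_fun_le => z Az; have /andP[_] := dual_ball1_le p1 (A1 Az).
Qed.

(** The shift by 2 makes the base positive on [- 1, 1], where squaring is increasing
    and strictly convex; division by 3 keeps the value in [0, 1]. *)
Definition penalty_term n p : R := ((2 + support_fun n p) / 3) ^+ 2.

Definition penalty_sum N p : R := \sum_(n < N) 2^-1 ^+ n.+1 * penalty_term n p.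

Definition penalty p : R := sup [set penalty_sum N p | N in [set: nat]].

Lemma penalty_sumS N p : penalty_sum N.+1 p =
  penalty_sum N p + 2^-1 ^+ N.+1 * penalty_term N p.
Proof. exact: big_ord_recr. Qed.

Let h_gt0 n : 0 < (2^-1 : R) ^+ n. Proof. by rewrite exprn_gt0// invr_gt0. Qed.

Lemma penalty_term_bound n p : dual_ball 1 p -> 0 <= penalty_term n p <= 1.
Proof.
by move=> /(support_fun_bound n) /andP[h1 h2]; rewrite sqr_ge0 /= expr_le1//; lra.
Qed.

Lemma penalty_sum_bound N p : dual_ball 1 p -> 0 <= penalty_sum N p <= 1 - 2^-1 ^+ N.
Proof.
move=> p1; elim: N => [|N /andP[h1 h2]].
  by rewrite /penalty_sum big_ord0 expr0 subrr lexx.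
rewrite penalty_sumS; have /andP[t0 t1] := penalty_term_bound N p1.
have : 0 <= 2^-1 ^+ N.+1 * penalty_term N p by rewrite mulr_ge0// ltW.
have : 2^-1 ^+ N.+1 * penalty_term N p <= 2^-1 ^+ N.+1 by rewrite ler_piMr// ltW.
have : (2^-1 : R) ^+ N.+1 = 2^-1 ^+ N / 2 by rewrite exprSr.
lra.
Qed.

Lemma penalty_sum_le N p : dual_ball 1 p -> penalty_sum N p <= penalty p.
Proof.
move=> p1; apply: ub_le_sup; last by exists N.
exists 1 => _ [n _ <-]; have /andP[_] := penalty_sum_bound n p1.
by have := h_gt0 n; lra.
Qed.

Lemma penalty_le p c : (forall N, penalty_sum N p <= c) -> penalty p <= c.
Proof.
move=> pc; apply: ge_sup => [|_ [N _ <-]]; last exact: pc.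
by exists (penalty_sum 0 p), 0%N.
Qed.

Lemma penalty_bound p : dual_ball 1 p -> 0 <= penalty p <= 1.
Proof.
move=> p1; apply/andP; split.
  by apply: le_trans (penalty_sum_le 0 p1); rewrite /penalty_sum big_ord0.
apply: penalty_le => N; have /andP[_] := penalty_sum_bound N p1.
by have := h_gt0 N; lra.
Qed.

Lemma midpoint_functional p q : exists r : {linear V -> R^o},
  forall x, r x = (p x + q x) / 2.
Proof.
apply: linear_of_fun => t x y.
change ((p (t *: x + y) + q (t *: x + y)) / 2 =
  t * ((p x + q x) / 2) + (p y + q y) / 2).
rewrite !linearP.
change ((t * p x + p y + (t * q x + q y)) / 2 =
  t * ((p x + q x) / 2) + (p y + q y) / 2).
by field.
Qed.

Lemma penalty_term_mid n p q r : dual_ball 1 p -> dual_ball 1 q ->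
  dual_ball 1 r -> (forall x, r x = (p x + q x) / 2) ->
  penalty_term n r <= (penalty_term n p + penalty_term n q) / 2
     - (support_fun n p - support_fun n q) ^+ 2 / 36.
Proof.
move=> p1 q1 r1 rE.
have sr : support_fun n r <= (support_fun n p + support_fun n q) / 2.
  apply: support_fun_le => z Az; rewrite rE.
  by have := support_fun_ge p1 Az; have := support_fun_ge q1 Az; lra.
have /andP[r0 _] := support_fun_bound n r1.
have : ((2 + support_fun n r) / 3) ^+ 2 <=
    ((2 + (support_fun n p + support_fun n q) / 2) / 3) ^+ 2.
  by rewrite lerXn2r ?nnegrE//; lra.
rewrite /penalty_term; lra.
Qed.

(** Strict midpoint convexity, quantified by the gap at each single index n. The
    identity ((a + b) / 2)^2 = (a^2 + b^2) / 2 - (a - b)^2 / 4 and the division by 3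
    give the constant 36. *)
Lemma penalty_mid n p q r : dual_ball 1 p -> dual_ball 1 q ->
  dual_ball 1 r -> (forall x, r x = (p x + q x) / 2) ->
  penalty r <= (penalty p + penalty q) / 2
     - 2^-1 ^+ n.+1 * ((support_fun n p - support_fun n q) ^+ 2 / 36).
Proof.
move=> p1 q1 r1 rE.
set g := (X in _ - X).
have g0 : 0 <= g by rewrite mulr_ge0 ?divr_ge0 ?sqr_ge0// ltW.
have conv N : penalty_sum N r <= (penalty_sum N p + penalty_sum N q) / 2
    - (if (n < N)%N then g else 0).
  elim: N => [|N IH]; first by rewrite /penalty_sum !big_ord0 ltn0; lra.
  rewrite !penalty_sumS.
  have : 2^-1 ^+ N.+1 * penalty_term N r <= 2^-1 ^+ N.+1 *
    ((penalty_term N p + penalty_term N q) / 2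
      - (support_fun N p - support_fun N q) ^+ 2 / 36).
    by apply: ler_wpM2l; [exact: ltW|exact: penalty_term_mid].
  have : 0 <= 2^-1 ^+ N.+1 * ((support_fun N p - support_fun N q) ^+ 2 / 36).
    by rewrite mulr_ge0 ?divr_ge0 ?sqr_ge0// ltW.
  rewrite [(n < N.+1)%N]ltnS [(n <= N)%N]leq_eqVlt.
  by move: IH; have [nN|nN|<-] := ltngtP n N; rewrite /= /g; lra.
apply: penalty_le => N.
have NM : penalty_sum N r <= penalty_sum (maxn N n.+1) r.
  rewrite /maxn; case: ltnP => // /ltnW/subnKC <-.
  elim: (_ - _)%N => [|k IH]; first by rewrite addn0.
  rewrite addnS penalty_sumS; apply: le_trans IH _; rewrite lerDl.
  by rewrite mulr_ge0 ?(ltW (h_gt0 _))//; case/andP: (penalty_term_bound (N + k) r1).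
apply: le_trans NM _; have := conv (maxn N n.+1); rewrite leq_max leqnn orbT.
by have := penalty_sum_le (maxn N n.+1) p1; have := penalty_sum_le (maxn N n.+1) q1; lra.
Qed.

(** Each partial sum is lower semicontinuous along the ultrafilter because the
    support values are. *)
Lemma penalty_lsc (U : set_system {linear V -> R^o}) p (c : R) :
  UltraFilter U -> U (dual_ball 1) -> dual_ball 1 p ->
  (forall x e, 0 < e -> U [set q | `|q x - p x| < e]) ->
  U [set q | penalty q <= c] -> penalty p <= c.
Proof.
move=> UU U1 p1 Up Uc; apply: penalty_le => N; apply/ler_addgt0Pr => e e0.
have Us n : U [set q | support_fun n p - e < support_fun n q].
  have e2 : 0 < e / 2 by lra.
  have [z Az pz] : exists2 z, A n z & support_fun n p - e / 2 < p z.
    have ne : [set p z | z in A n] !=set0 by have [z Az] := A0 n; exists (p z), z.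
    have ub : has_ubound [set p z | z in A n].
      by exists (support_fun n p) => _ [z Az <-]; exact: support_fun_ge.
    by have [_ [z Az <-] pz] := sup_adherent e2 (conj ne ub); exists z.
  apply: filterS (filterI U1 (Up z _ e2)) => q [q1 /=].
  by rewrite ltr_norml => /andP[qz _]; have := support_fun_ge q1 Az; lra.
have Un : U [set q | penalty_sum N p <= penalty_sum N q + e].
  have : U [set q | penalty_sum N p <= penalty_sum N q + e * (1 - 2^-1 ^+ N)].
    elim: N => [|N IH].
      by apply: filterS U1 => q q1 /=; rewrite /penalty_sum !big_ord0 expr0; lra.
    apply: filterS (filterI (filterI IH U1) (Us N)) => q [[/= h1 q1] h2].
    rewrite !penalty_sumS.
    have /andP[p0 p2] := support_fun_bound N p1.
    have /andP[q0 q2] := support_fun_bound N q1.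
    have : penalty_term N p <= penalty_term N q + e.
      rewrite /penalty_term; have [pq|pq] := leP (support_fun N p) (support_fun N q).
        have : ((2 + support_fun N p) / 3) ^+ 2 <= ((2 + support_fun N q) / 3) ^+ 2.
          by rewrite lerXn2r ?nnegrE//; lra.
        lra.
      have : (support_fun N p - support_fun N q)
           * (4 + support_fun N p + support_fun N q) <=
         (support_fun N p - support_fun N q) * 6 by apply: ler_wpM2l; lra.
      lra.
    rewrite -(ler_pM2l (h_gt0 N.+1)) => h3.
    have hE : (2^-1 : R) ^+ N = 2 * 2^-1 ^+ N.+1 by rewrite exprS mulrA divff// mul1r.
    by move: h1 h3; rewrite hE; lra.
  apply: filterS => q /=; have := mulr_gt0 e0 (h_gt0 N); lra.
have [q [[/= qc q1] h]] := filter_ex (filterI (filterI Uc U1) Un).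
by have := penalty_sum_le N q1; lra.
Qed.

Definition smooth_norm (eps : R) (x : V) : R :=
  sup [set p x - eps * penalty p | p in dual_ball 1].

Section Eps.
Variable eps : R.
Hypothesis eps_gt0 : 0 < eps.

Lemma smooth_norm_ge p x : dual_ball 1 p ->
  p x - eps * penalty p <= smooth_norm eps x.
Proof.
move=> p1; apply: ub_le_sup; last by exists p.
exists `|x| => _ [q q1 <-]; have /andP[q0 _] := penalty_bound q1.
have := mulr_ge0 (ltW eps_gt0) q0; have := q1 x; rewrite mul1r.
by have := ler_norm (q x); lra.
Qed.

Lemma smooth_norm_le x c :
  (forall p, dual_ball 1 p -> p x - eps * penalty p <= c) ->
  smooth_norm eps x <= c.
Proof.
move=> pc; apply: ge_sup => [|_ [p p1 <-]]; last exact: pc.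
by have [p p1 _] := norming_functional x; eexists; exists p.
Qed.

Lemma smooth_norm_adherent x b : 0 < b -> exists2 p, dual_ball 1 p &
  smooth_norm eps x - b < p x - eps * penalty p.
Proof.
move=> b0.
have ne : [set p x - eps * penalty p | p in dual_ball 1] !=set0.
  by have [p p1 _] := norming_functional x; eexists; exists p.
have ub : has_ubound [set p x - eps * penalty p | p in dual_ball 1].
  by exists (smooth_norm eps x) => _ [p p1 <-]; exact: smooth_norm_ge.
by have [_ [p p1 <-] h] := sup_adherent b0 (conj ne ub); exists p.
Qed.

Lemma smooth_norm_lip x y : smooth_norm eps x <= smooth_norm eps y + `|x - y|.
Proof.
apply: smooth_norm_le => p p1; have := smooth_norm_ge y p1.
have := p1 (x - y); rewrite linearB mul1r; have := ler_norm (p x - p y); lra.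
Qed.

Lemma smooth_norm_le_norm x : smooth_norm eps x <= `|x|.
Proof.
apply: smooth_norm_le => p p1; have := p1 x; rewrite mul1r.
have /andP[q0 _] := penalty_bound p1.
have := mulr_ge0 (ltW eps_gt0) q0; have := ler_norm (p x); lra.
Qed.

Lemma smooth_norm_ge_norm x : `|x| - eps <= smooth_norm eps x.
Proof.
have [p p1 px] := norming_functional x.
apply: le_trans (smooth_norm_ge x p1); rewrite px lerB//.
by rewrite ler_piMr ?(ltW eps_gt0)//; have /andP[] := penalty_bound p1.
Qed.

(** Near-maximizers form a filter; the limit of a finer ultrafilter is a maximizer
    by lower semicontinuity of the penalty. *)
Lemma smooth_norm_attained x : exists2 p, dual_ball 1 p &
  smooth_norm eps x <= p x - eps * penalty p.
Proof.
pose M b := [set p | dual_ball 1 p /\ smooth_norm eps x - b <= p x - eps * penalty p].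
pose F := filter_from [set b : R | 0 < b] M.
have FF : ProperFilter F.
  apply: filter_from_proper; last first.
    move=> b b0; have [p p1 pb] := smooth_norm_adherent x b0.
    by exists p; split => //; exact: ltW.
  apply: filter_from_filter; first by exists 1; exact: ltr01.
  move=> a b a0 b0; exists (Num.min a b); first by rewrite /= lt_min a0.
  move=> p [p1 pab].
  have : Num.min a b <= a by rewrite ge_min lexx.
  have : Num.min a b <= b by rewrite ge_min lexx orbT.
  by move=> h1 h2; split; split => //; lra.
have [U [UU FU]] := ultraFilterLemma FF.
have UM b : 0 < b -> U (M b) by move=> b0; apply: FU; exists b.
have U1 : U (dual_ball 1) by apply: filterS (UM _ ltr01) => p [].
have [p p1 Up] := weakstar_limit UU U1.
exists p => //.
suff : penalty p <= (p x - smooth_norm eps x) / eps.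
  by rewrite ler_pdivlMr//; lra.
apply/ler_addgt0Pr => e e0.
have e2 : 0 < eps * e / 2 by rewrite divr_gt0// mulr_gt0.
apply: (penalty_lsc UU U1 p1 Up).
apply: filterS (filterI (UM _ e2) (Up x _ e2)) => q [[q1 h1] /=].
rewrite ltr_norml => /andP[h2 h3].
rewrite -lerBlDr ler_pdivlMr//; lra.
Qed.

(** The midpoint of p and q cannot beat the supremum, so the convexity gap of the
    penalty is bounded by the defect b of q. *)
Lemma near_maximizer_support x p q b n : dual_ball 1 p -> dual_ball 1 q ->
  smooth_norm eps x <= p x - eps * penalty p ->
  smooth_norm eps x - b <= q x - eps * penalty q ->
  eps * 2^-1 ^+ n.+1 / 36 * (support_fun n q - support_fun n p) ^+ 2 <= b.
Proof.
move=> p1 q1 hp hq; have [r rE] := midpoint_functional p q.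
have r1 : dual_ball 1 r.
  move=> y; rewrite rE normrM [`|2^-1|]gtr0_norm//.
  by have := p1 y; have := q1 y; have := ler_normD (p y) (q y); lra.
have := smooth_norm_ge x r1; rewrite rE.
have := penalty_mid n p1 q1 r1 rE; rewrite -(ler_pM2l eps_gt0).
have : 0 <= eps * 2^-1 ^+ n.+1 / 36 * (support_fun n q - support_fun n p) ^+ 2.
  by rewrite mulr_ge0 ?sqr_ge0// divr_ge0// mulr_ge0// ltW.
lra.
Qed.

Lemma near_maximizer_support_small x p n e : dual_ball 1 p -> 0 < e ->
  smooth_norm eps x <= p x - eps * penalty p ->
  exists2 b, 0 < b & forall q, dual_ball 1 q ->
    smooth_norm eps x - b <= q x - eps * penalty q ->
    `|support_fun n q - support_fun n p| <= e.
Proof.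
move=> p1 e0 hp; have k0 : 0 < eps * 2^-1 ^+ n.+1 / 36.
  by rewrite divr_gt0// mulr_gt0.
exists (eps * 2^-1 ^+ n.+1 / 36 * e ^+ 2); first by rewrite mulr_gt0// exprn_gt0.
move=> q q1 hq; have := near_maximizer_support n p1 q1 hp hq.
rewrite ler_pM2l// -[X in X <= _]real_normK ?num_real//.
by rewrite ler_pXn2r// ?nnegrE// ltW.
Qed.

(** A near-maximizer q at x + y is a near-maximizer at x up to an error of order |y|,
    and, with theta = smooth_norm eps, theta (x + y) - theta x <= q y + o(|y|); uniform convergence of
    near-maximizers to p on Y replaces q y by p y. *)
Lemma smooth_norm_supergradient x p : dual_ball 1 p ->
  smooth_norm eps x <= p x - eps * penalty p ->
  forall (Y : set V),
  (forall e, 0 < e -> exists2 b, 0 < b & forall q, dual_ball 1 q ->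
    smooth_norm eps x - b <= q x - eps * penalty q ->
    forall y, Y y -> `|q y - p y| <= e * `|y|) ->
  forall e, 0 < e -> exists2 d, 0 < d & forall y, Y y -> `|y| < d ->
    smooth_norm eps (x + y) <= smooth_norm eps x + p y + e * `|y|.
Proof.
move=> p1 hp Y HY e e0; have e2 : 0 < e / 2 by lra.
have [b b0 Hb] := HY _ e2.
have c0 : 0 < 2 + e by lra.
exists (b / (2 + e)); first by rewrite divr_gt0.
move=> y Yy; rewrite ltr_pdivlMr// => yd.
have [->|y0] := eqVneq y 0; first by rewrite addr0 linear0 normr0; lra.
have ey : 0 < e / 2 * `|y| by rewrite mulr_gt0// normr_gt0.
have [q q1 hq] := smooth_norm_adherent (x + y) ey.
move: (hq); rewrite linearD => hq'.
have qx := smooth_norm_ge x q1.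
have qb : smooth_norm eps x - b <= q x - eps * penalty q.
  have := smooth_norm_lip x (x + y); rewrite opprD addrA subrr add0r normrN.
  have := q1 y; rewrite mul1r; have := ler_norm (q y); lra.
have := Hb q q1 qb y Yy; have := ler_norm (q y - p y); lra.
Qed.

End Eps.
End SmoothNorm.

Lemma countable_enum (T : Type) (D : set T) d0 : countable D -> D d0 ->
  exists2 e : nat -> T, (forall n, D (e n)) & forall d, D d -> exists n, e n = d.
Proof.
move=> /countable_injP[f finj] Dd0.
have /choice[e eP] : forall n : nat, exists d, D d /\
    ((exists d', D d' /\ f d' = n) -> f d = n).
  move=> n; have [[d [Dd fd]]|nd] := pselect (exists d', D d' /\ f d' = n).
    by exists d.
  by exists d0; split => // /nd.
exists e => [n|d Dd]; first exact: (eP n).1.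
exists (f d); apply: finj; rewrite ?inE//; first exact: (eP _).1.
by apply: (eP (f d)).2; exists d.
Qed.

(** The functions q k stand for a dense sequence in the dual of Y, seen through their
    restrictions to the unit ball of Y. *)
Section SeparableDual.
Context {R : realType} {V : normedModType R}.
Variables (Y : set V) (e : nat -> V) (q : nat -> V -> R).
Hypothesis YZ : forall t x, Y x -> Y (t *: x).
Hypothesis Ye : forall n, Y (e n).
Hypothesis e_dense : forall y r, Y y -> 0 < r -> exists n, `|y - e n| < r.
Hypothesis q_bounded : forall k, exists C, forall z, Y z -> `|z| <= 1 -> `|q k z| <= C.
Hypothesis q_dense : forall p r, dual_ball 1 p -> 0 < r ->
  exists k, forall z, Y z -> `|z| <= 1 -> `|p z - q k z| <= r.
Implicit Types (p : {linear V -> R^o}).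

Definition unit_ball_of : set V := [set z | Y z /\ `|z| <= 1].

(** Total boundedness of the unit ball for the pseudometric given by finitely many
    bounded functions, by pigeonhole on one function after the other. *)
Lemma finite_net n (r : R) (B : set V) : 0 < r -> B `<=` unit_ball_of ->
  exists W : seq V, (forall w, w \in W -> B w) /\
    forall x, B x -> exists2 w, w \in W &
      forall k, (k < n)%N -> `|q k x - q k w| <= r.
Proof.
move=> r0; elim: n B => [|n IH] B Bu.
  have [[b Bb]|B0] := pselect (B !=set0).
    exists [:: b]; split => [w|x _]; first by rewrite inE => /eqP->.
    by exists b; rewrite ?inE.
  by exists [::]; split => // x Bx; case: B0; exists x.
have [C qC] := q_bounded n.
pose cell x := Num.truncn ((q n x + C) / r).
have /choice[W WP] : forall j, exists W : seq V,
    (forall w, w \in W -> (B `&` [set x | cell x = j]) w) /\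
    forall x, (B `&` [set x | cell x = j]) x -> exists2 w, w \in W &
      forall k, (k < n)%N -> `|q k x - q k w| <= r.
  by move=> j; apply: IH => x [/Bu].
exists (flatten [seq W j | j <- iota 0 (Num.truncn (2 * C / r)).+1]); split.
  by move=> w /flattenP[_ /mapP[j _ ->]] /(WP j).1[].
move=> x Bx; have [Yx x1] := Bu _ Bx.
have cell_itv y : B y -> (cell y)%:R <= (q n y + C) / r < (cell y).+1%:R.
  move=> /Bu[Yy y1]; apply: truncn_itv; apply: divr_ge0 (ltW r0).
  by have := qC y Yy y1; rewrite ler_norml => /andP[]; lra.
have [w Ww wk] := (WP (cell x)).2 x (conj Bx erefl).
have [Bw cw] := (WP (cell x)).1 _ Ww.
exists w.
  apply/flattenP; exists (W (cell x)) => //; apply/mapP; exists (cell x) => //.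
  rewrite mem_iota /= add0n ltnS; apply: le_truncn.
  apply: ler_wpM2r; first by rewrite invr_ge0 ltW.
  by have := qC x Yx x1; rewrite ler_norml => /andP[]; lra.
move=> k; rewrite ltnS leq_eqVlt => /orP[/eqP->|/wk//].
have /andP[] := cell_itv x Bx; have /andP[] := cell_itv w Bw.
rewrite cw -natr1 !ler_pdivlMr// !ltr_pdivrMr// ler_norml; lra.
Qed.

(** Half-differences of points of the unit ball of Y that q 0, ..., q (n - 1) almost
    do not separate. A functional close to some q k has a small supremum over this
    set for large n, while finitely many points of the ball reach all of it up to such
    differences. These sets replace the finite-dimensional distances of the
    Kadets-Klee renorming. *)
Definition almost_annihilator n : set V :=
  [set z | exists a b, [/\ unit_ball_of a, unit_ball_of b,
     (forall k, (k < n)%N -> `|q k a - q k b| <= n.+1%:R^-1) &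
     z = 2^-1 *: (a - b)]].

(** Even indices test p at the points of a dense sequence scaled into the unit ball,
    which yields pointwise convergence; odd indices upgrade it to norm convergence. *)
Definition test_sets n : set V :=
  if odd n then almost_annihilator n./2
  else [set (1 + `|e n./2|)^-1 *: e n./2].

Lemma test_sets0 n : test_sets n !=set0.
Proof.
rewrite /test_sets; case: ifP => _; last by eexists; reflexivity.
have u0 : unit_ball_of 0.
  by split; [rewrite -(scale0r (e 0)); exact: YZ|rewrite normr0].
exists 0, 0, 0; split => //; last by rewrite subrr scaler0.
by move=> k _; rewrite subrr normr0.
Qed.

Lemma test_sets1 n z : test_sets n z -> `|z| <= 1.
Proof.
rewrite /test_sets; case: ifP => _.
  move=> [a [b [[_ a1] [_ b1] _ ->]]]; rewrite normrZ gtr0_norm//.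
  by have := ler_normB a b; lra.
move=> ->; rewrite normrZ gtr0_norm ?invr_gt0 ?ltr_wpDr//.
by rewrite mulrC ler_pdivrMr ?ltr_wpDr// mul1r lerDr.
Qed.

Section NearMaximizers.
Variables (eps : R) (x : V) (p : {linear V -> R^o}).
Hypothesis eps_gt0 : 0 < eps.
Hypothesis p1 : dual_ball 1 p.
Hypothesis p_max : smooth_norm test_sets eps x <= p x - eps * penalty test_sets p.

Let near b p' := dual_ball 1 p' /\
  smooth_norm test_sets eps x - b <= p' x - eps * penalty test_sets p'.

Lemma near_maximizer_support_cvg n r : 0 < r ->
  exists2 b, 0 < b & forall p', near b p' ->
    `|support_fun test_sets n p' - support_fun test_sets n p| <= r.
Proof.
move=> r0.
have [b b0 H] := near_maximizer_support_small test_sets0 test_sets1 eps_gt0 n p1 r0 p_max.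
by exists b => // p' [h1 h2]; exact: H.
Qed.

Lemma near_maximizer_pointwise y r : Y y -> 0 < r ->
  exists2 b, 0 < b & forall p', near b p' -> `|p' y - p y| <= r.
Proof.
move=> Yy r0; have r4 : 0 < r / 4 by lra.
have [n yn] := e_dense Yy r4.
have c0 : 0 < 1 + `|e n| by rewrite ltr_wpDr.
have r2 : 0 < r / 2 / (1 + `|e n|) by rewrite !divr_gt0.
have sE p' : support_fun test_sets n.*2 p' = p' (e n) / (1 + `|e n|).
  rewrite /support_fun /test_sets odd_double doubleK image_set1 sup1.
  by rewrite linearZ mulrC.
have [b b0 H] := near_maximizer_support_cvg n.*2 r2.
exists b => // p' np'; have := H _ np'; rewrite !sE -mulrBl normrM.
rewrite (gtr0_norm (_ : 0 < (1 + `|e n|)^-1)) ?invr_gt0// ler_pM2r ?invr_gt0//.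
move=> h; have := np'.1 (y - e n); have := p1 (y - e n); rewrite !linearB !mul1r.
have -> : p' y - p y = (p' y - p' (e n)) + (p' (e n) - p (e n)) - (p y - p (e n)).
  by ring.
have := ler_normB (p' y - p' (e n) + (p' (e n) - p (e n))) (p y - p (e n)).
have := ler_normD (p' y - p' (e n)) (p' (e n) - p (e n)).
lra.
Qed.

Lemma near_maximizer_finite (W : seq V) r : (forall w, w \in W -> Y w) -> 0 < r ->
  exists2 b, 0 < b & forall p', near b p' -> forall w, w \in W -> `|p' w - p w| <= r.
Proof.
move=> WY r0; elim: W WY => [_|w W IH WY]; first by exists 1.
have [|b1 b10 H1] := IH; first by move=> v vW; apply: WY; rewrite inE vW orbT.
have [|b2 b20 H2] := @near_maximizer_pointwise w r _ r0.
  by apply: WY; rewrite inE eqxx.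
exists (Num.min b1 b2); first by rewrite lt_min b10.
move=> p' [h1 h2] v; rewrite inE => /orP[/eqP->|vW].
  by apply: H2; split => //; have : Num.min b1 b2 <= b2; [rewrite ge_min lexx orbT|lra].
apply: H1 => //; split => //.
by have : Num.min b1 b2 <= b1; [rewrite ge_min lexx|lra].
Qed.

(** Approximate the maximizer p by some q k, so that its supremum over a suitable
    almost annihilator is small. By the convexity gap the same holds for every
    near-maximizer p'. On a finite net p' and p are close pointwise, and the rest of
    the unit ball differs from the net by elements of twice the almost annihilator. *)
Lemma near_maximizer_uniform r : 0 < r -> exists2 b, 0 < b &
  forall p', near b p' -> forall y, Y y -> `|p' y - p y| <= r * `|y|.
Proof.
move=> r0; have s0 : 0 < r / 9 by lra.
set s := r / 9 in s0 *.
(* the total error below is 9 s: s on the net, 2 * 5/2 s for p', 2 * 3/2 s for p *)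
have [k pk] := q_dense p1 s0.
have [N [kN Ns]] : exists N, (k < N)%N /\ N.+1%:R^-1 <= s.
  have [N1 _ H] := near_infty_natSinv_lt (PosNum s0).
  exists (maxn k.+1 N1); split; first by rewrite leq_max leqnn.
  by apply/ltW/H; rewrite /= leq_max leqnn orbT.
have pN : support_fun test_sets N.*2.+1 p <= 3 / 2 * s.
  apply: (support_fun_le test_sets0) => z; rewrite /test_sets /= odd_double /=.
  rewrite uphalf_double => -[a [b [[Ya a1] [Yb b1] ab ->]]].
  rewrite linearZ linearB.
  change (2^-1 * (p a - p b) <= 3 / 2 * s).
  have := pk _ Ya a1; have := pk _ Yb b1; have := ab k kN.
  rewrite !ler_norml => /andP[_ h1] /andP[h2 h3] /andP[h4 h5].
  by have h6 := le_trans h1 Ns; lra.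
have [b1 b10 H1] := near_maximizer_support_cvg N.*2.+1 s0.
have N0 : 0 < N.+1%:R^-1 :> R by rewrite invr_gt0.
have [W [WY Wnet]] := finite_net N N0 (@subset_refl _ unit_ball_of).
have [|b2 b20 H2] := @near_maximizer_finite W s _ s0; first by move=> w /WY[].
have unitP y w p' : dual_ball 1 p' -> unit_ball_of y -> unit_ball_of w ->
    (forall j, (j < N)%N -> `|q j y - q j w| <= N.+1%:R^-1) ->
    p' y - p' w <= 2 * support_fun test_sets N.*2.+1 p'.
  move=> p'1 uy uw yw.
  suff : p' (2^-1 *: (y - w)) <= support_fun test_sets N.*2.+1 p'.
    rewrite linearZ linearB => h.
    have : 2^-1 * (p' y - p' w) <= support_fun test_sets N.*2.+1 p' by [].
    lra.
  apply: (support_fun_ge test_sets1 p'1).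
  by rewrite /test_sets /= odd_double /= uphalf_double; exists y, w.
exists (Num.min b1 b2); first by rewrite lt_min b10.
move=> p' [h1 h2].
have n1 : near b1 p'.
  by split => //; have : Num.min b1 b2 <= b1; [rewrite ge_min lexx|lra].
have n2 : near b2 p'.
  by split => //; have : Num.min b1 b2 <= b2; [rewrite ge_min lexx orbT|lra].
have uB y : unit_ball_of y -> `|p' y - p y| <= r.
  move=> uy; have [w Ww yw] := Wnet y uy; have uw := WY w Ww.
  have wy j : (j < N)%N -> `|q j w - q j y| <= N.+1%:R^-1.
    by move=> /yw; rewrite distrC.
  have := H2 _ n2 w Ww; have := H1 _ n1; rewrite !ler_norml => /andP[_ h3] /andP[h4 h5].
  have := unitP _ _ _ p1 uy uw yw; have := unitP _ _ _ p1 uw uy wy.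
  have := unitP _ _ _ h1 uy uw yw; have := unitP _ _ _ h1 uw uy wy.
  move: h3 h4 h5 pN; rewrite /s; lra.
move=> y Yy; have [->|y0] := eqVneq y 0.
  have p'0 : p' 0 = 0 by exact: linear0.
  have p00 : p 0 = 0 by exact: linear0.
  by rewrite p'0 p00 subr0 !normr0 mulr0.
have ny : 0 < `|y| by rewrite normr_gt0.
have : `|p' (`|y|^-1 *: y) - p (`|y|^-1 *: y)| <= r.
  apply: uB; split; first exact: YZ.
  by rewrite normrZ gtr0_norm ?invr_gt0// mulVf// gt_eqF.
have pE (g : {linear V -> R^o}) : g (`|y|^-1 *: y) = `|y|^-1 * g y.
  by rewrite linearZ.
rewrite !pE -mulrBr normrM (gtr0_norm (_ : 0 < `|y|^-1)) ?invr_gt0//.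
by rewrite ler_pdivrMl// mulrC.
Qed.

End NearMaximizers.

Lemma separable_smooth_norm : exists theta : R -> V -> R, forall eps, 0 < eps ->
  [/\ forall x y, theta eps x <= theta eps y + `|x - y|,
      forall x, `|x| - eps <= theta eps x,
      forall x, theta eps x <= `|x| &
      forall x, exists2 p, dual_ball 1 p & forall r, 0 < r ->
        exists2 d, 0 < d & forall y, Y y -> `|y| < d ->
          theta eps (x + y) <= theta eps x + p y + r * `|y|].
Proof.
exists (smooth_norm test_sets) => eps eps0; split.
- by move=> *; apply: smooth_norm_lip => //; [exact: test_sets0|exact: test_sets1].
- by move=> *; apply: smooth_norm_ge_norm => //; [exact: test_sets0|exact: test_sets1].
- by move=> *; apply: smooth_norm_le_norm => //; [exact: test_sets0|exact: test_sets1].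
- move=> x; have [p p1 pmax] := smooth_norm_attained test_sets0 test_sets1 eps0 x.
  exists p => // r r0.
  apply: (smooth_norm_supergradient test_sets0 test_sets1 eps0 p1 pmax) => // s s0.
  have [b b0 H] := near_maximizer_uniform eps0 p1 pmax s0.
  by exists b => // p' p'1 np'; exact: H.
Qed.

End SeparableDual.

(** A function of the dense set may fail to be bounded on the unit ball of Y; it is
    then replaced by 0, which is harmless because it approximates no functional. *)
Lemma separable_dual_smooth_norm (R : realType) (V : normedModType R) (Y D : set V) :
  (forall t x, Y x -> Y (t *: x)) -> D !=set0 -> countable D -> D `<=` Y ->
  Y `<=` closure D -> separable_dual Y ->
  exists theta : R -> V -> R, forall eps, 0 < eps ->
  [/\ forall x y, theta eps x <= theta eps y + `|x - y|,
      forall x, `|x| - eps <= theta eps x,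
      forall x, theta eps x <= `|x| &
      forall x, exists2 p : {linear V -> R^o}, dual_ball 1 p & forall r, 0 < r ->
        exists2 d, 0 < d & forall y, Y y -> `|y| < d ->
          theta eps (x + y) <= theta eps x + p y + r * `|y|].
Proof.
move=> YZ [d0 Dd0] cD DY YD [H [cH Hdual Hdense]].
have dualP (p : {linear V -> R^o}) : dual_ball 1 p -> dual_on Y p.
  move=> p1; split; first by move=> t y z _ _; rewrite linearP.
  by apply: continuous_subspaceT; exact: dual_ball_continuous p1.
have normP (g : V -> R) r z : (functional_norm Y g < r%:E)%E ->
    Y z -> `|z| <= 1 -> `|g z| <= r.
  move=> gr Yz z1; rewrite -lee_fin; apply: le_trans (ltW gr).
  by apply: le_ereal_sup_tmp; eexists; first by exists z.
have [p0 p01 _] := norming_functional (0 : V).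
have [h0 Hh0 _] := Hdense _ (dualP _ p01) 1 ltr01.
have [hs Hhs hsP] := countable_enum cH Hh0.
have [e De eP] := countable_enum cD Dd0.
pose bnd (g : V -> R) := exists C, forall z, Y z -> `|z| <= 1 -> `|g z| <= C.
pose q k := if pselect (bnd (hs k)) then hs k else (fun=> 0).
apply: (@separable_smooth_norm R V Y e q) => //.
- by move=> n; exact: DY.
- move=> y r Yy r0; have [z [Dz]] := YD _ Yy _ (nbhsx_ballx y _ r0).
  by rewrite -ball_normE /=; have [n <-] := eP _ Dz; exists n.
- move=> k; rewrite /q; case: pselect => [//|?] /=.
  by exists 0 => z _ _; rewrite normr0.
- move=> p r p1 r0; have [h Hh hr] := Hdense _ (dualP _ p1) _ r0.
  have [k hk] := hsP _ Hh.
  have ph z : Y z -> `|z| <= 1 -> `|p z - h z| <= r by exact: normP hr.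
  have bh : bnd h.
    exists (1 + r) => z Yz z1; have -> : h z = p z - (p z - h z) by ring.
    apply: le_trans (ler_normB _ _) _; apply: lerD; last exact: ph.
    by apply: le_trans (p1 z) _; rewrite mul1r.
  by exists k => z Yz z1; rewrite /q hk; case: pselect => [?|//] /=; exact: ph.
Qed.

(** * Separable reduction *)

(** The set of values of all finite terms built from the operations. *)
Lemma countable_stable_set (T : eqType) (I : countType) (op : I -> seq T -> T) (t0 : T) :
  exists D : set T, [/\ countable D, D t0 &
    forall i l, (forall t, t \in l -> D t) -> D (op i l)].
Proof.
pose ev := fix ev (t : GenTree.tree nat) : T :=
  if t is GenTree.Node n l then
    if @unpickle I n is Some i then op i (map ev l) else t0
  else t0.
exists (range ev); split.
- apply: (sub_countable (card_image_le _ _)); exact: countableP.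
- by exists (GenTree.Leaf 0).
- move=> i l lD.
  have [s sl] : exists s, map ev s = l.
    elim: l lD => [|t l IH] lD; first by exists [::].
    have [|s <-] := IH; first by move=> v vl; apply: lD; rewrite inE vl orbT.
    by have [|x _ <-] := lD t; [rewrite inE eqxx|exists (x :: s)].
  by exists (GenTree.Node (pickle i) s) => //=; rewrite pickleK sl.
Qed.

(** A certificate at (y, a) is a finite list of triples (weight, k, u); each triple
    stands for the constraint p (u - y) <= f u - a + |u - y| / (k + 1), which a
    Frechet subgradient p satisfies for u within 1 / (m k + 1) of y, where m records
    the radii of the liminf condition. A weighted sum of constraints which contradicts
    the bound |p| <= c shows that no p exists. A certificate uses only finitely many
    radii, whence the list M instead of m: there are countably many such lists. *)
Section SeparableReduction.
Context {R : realType} {V : normedModType R}.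
Variables (f : V -> \bar R) (c : R).
Hypothesis c_ge0 : 0 <= c.
Hypothesis f_ge0 : forall x, (0 <= f x)%E.
Implicit Types (y u : V) (a : R) (s : seq (R * nat * V)) (M : seq nat) (m : nat -> nat).

Lemma closure_normP (D : set V) y :
  closure D y <-> forall r, 0 < r -> exists2 d, D d & `|y - d| < r.
Proof.
split=> [cDy r r0|H B].
  have [d [Dd]] := cDy _ (nbhsx_ballx y _ r0).
  by rewrite -ball_normE /= => ?; exists d.
move=> /nbhs_ballP[r /= r0 rB]; have [d Dd yd] := H _ r0.
by exists d; split => //; apply: rB; rewrite -ball_normE.
Qed.

Definition cert_weight s : R := \sum_(t <- s) t.1.1.
Definition cert_vec y s : V := \sum_(t <- s) t.1.1 *: (t.2 - y).
Definition cert_val a y s : R :=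
  \sum_(t <- s) t.1.1 * (fine (f t.2) - a + `|t.2 - y| / t.1.2.+1%:R).

Definition cert_ok m y s := forall t, t \in s ->
  [/\ 0 < t.1.1, f t.2 \is a fin_num & `|t.2 - y| < (m t.1.2).+1%:R^-1].

Definition certificate M a y s :=
  [/\ cert_ok (nth 0%N M) y s, (forall t, t \in s -> (t.1.2 < size M)%N) &
      cert_val a y s + c * `|cert_vec y s| < 0].

Lemma cert_weight_ge0 m y s : cert_ok m y s -> 0 <= cert_weight s.
Proof.
move=> ok; rewrite /cert_weight big_seq; apply: sumr_ge0 => t /ok[/ltW].
by [].
Qed.

Lemma cert_val_lip m a a' y y' s : cert_ok m y s ->
  cert_val a' y' s <= cert_val a y s + cert_weight s * (`|a - a'| + `|y - y'|).
Proof.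
elim: s => [|t s IH] ok.
  by rewrite /cert_val /cert_weight !big_nil mul0r addr0.
rewrite /cert_val /cert_weight !big_cons -!/(cert_val _ _ s) -!/(cert_weight s).
have {}IH := IH (fun v vs => ok v (mem_behead (s := t :: s) vs)).
have [t0 _ _] := ok t (mem_head _ _).
have : t.1.1 * (fine (f t.2) - a' + `|t.2 - y'| / t.1.2.+1%:R) <=
  t.1.1 * (fine (f t.2) - a + `|t.2 - y| / t.1.2.+1%:R + (`|a - a'| + `|y - y'|)).
  apply: ler_wpM2l; first exact: ltW.
  have : `|t.2 - y'| / t.1.2.+1%:R <= `|t.2 - y| / t.1.2.+1%:R + `|y - y'|.
    rewrite ler_pdivrMr// mulrDl divfK ?pnatr_eq0//.
    have : `|t.2 - y'| <= `|t.2 - y| + `|y - y'|.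
      by apply: le_trans (ler_normD _ _); rewrite addrA subrK.
    by move=> /le_trans; apply; rewrite lerD2l ler_peMr// ler1n.
  have := ler_norm (a - a').
  by move: (`|t.2 - y'| / _) (`|t.2 - y| / _) => A B; lra.
move: (`|t.2 - y'| / _) (`|t.2 - y| / _) => A B; lra.
Qed.

Lemma cert_vec_lip m y y' s : cert_ok m y s ->
  `|cert_vec y' s| <= `|cert_vec y s| + cert_weight s * `|y - y'|.
Proof.
move=> ok; have -> : cert_vec y' s = cert_vec y s + cert_weight s *: (y - y').
  rewrite /cert_vec /cert_weight scaler_suml -big_split /=.
  by apply: eq_bigr => t _; rewrite -scalerDr addrA subrK.
apply: le_trans (ler_normD _ _) _.
by rewrite normrZ [`|cert_weight s|]ger0_norm// (cert_weight_ge0 ok).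
Qed.

(** All requirements are strict and finitely many, so they survive small changes of y
    and a. The values of f occur only at the points u of the list, while f y enters as
    the number a. *)
Lemma certificate_open M a y s : certificate M a y s ->
  exists2 r, 0 < r & forall y' a', `|y - y'| < r -> `|a - a'| < r ->
    certificate M a' y' s.
Proof.
move=> [ok sM val].
have [r1 r10 H1] : exists2 r, 0 < r & forall y', `|y - y'| < r ->
    cert_ok (nth 0%N M) y' s.
  elim: s ok {sM val} => [|t s IH] ok; first by exists 1.
  have [r r0 Hr] := IH (fun v vs => ok v (mem_behead (s := t :: s) vs)).
  have [t0 ft ty] := ok t (mem_head _ _).
  exists (Num.min r ((nth 0%N M t.1.2).+1%:R^-1 - `|t.2 - y|)).
    by rewrite lt_min r0 subr_gt0.
  move=> y'; rewrite lt_min => /andP[yr yt] v; rewrite inE => /orP[/eqP->|].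
    split => //; rewrite ltrBrDl in yt; apply: le_lt_trans yt.
    by apply: le_trans (ler_normD _ _); rewrite addrA subrK.
  exact: Hr.
have w0 := cert_weight_ge0 ok.
pose g := - (cert_val a y s + c * `|cert_vec y s|).
have g0 : 0 < g by rewrite oppr_gt0.
have L0 : 0 < cert_weight s * (2 + c) + 1.
  by rewrite ltr_wpDl// mulr_ge0// addr_ge0.
exists (Num.min r1 (g / (cert_weight s * (2 + c) + 1))).
  by rewrite lt_min r10 divr_gt0.
move=> y' a'; rewrite !lt_min => /andP[y1 y2] /andP[_ a2]; split => //; first exact: H1.
have h1 := cert_val_lip a a' y' ok.
have h2 : c * `|cert_vec y' s| <= c * (`|cert_vec y s| + cert_weight s * `|y - y'|).
  by apply: ler_wpM2l => //; exact: cert_vec_lip ok.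
move: y2 a2; set r := g / _ => y2 a2.
have h3 : r * (cert_weight s * (2 + c) + 1) = g by rewrite /r divfK// gt_eqF.
have r0 : 0 < r by rewrite /r divr_gt0.
have h4 : cert_weight s * (`|a - a'| + `|y - y'|) <= cert_weight s * (r + r).
  by apply: ler_wpM2l => //; lra.
have h5 : c * cert_weight s * `|y - y'| <= c * cert_weight s * r.
  by apply: ler_wpM2l; [rewrite mulr_ge0|exact: ltW].
move: h3; rewrite /g; lra.
Qed.

(** This is the sandwich lemma for the cone generated by the constraints. *)
Lemma subgradient_or_certificate a y m :
  (exists2 p : {linear V -> R^o}, dual_ball c p & forall k u, f u \is a fin_num ->
     `|u - y| < (m k).+1%:R^-1 -> p (u - y) <= fine (f u) - a + `|u - y| / k.+1%:R)
  \/ exists s, cert_ok m y s /\ cert_val a y s + c * `|cert_vec y s| < 0.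
Proof.
have [?|nc] := pselect (exists s, cert_ok m y s /\
  cert_val a y s + c * `|cert_vec y s| < 0); first by right.
left.
pose K := [set k | exists2 s, cert_ok m y s & k = (cert_vec y s, cert_val a y s)].
have [|||p pc pK] := @sandwich R V c K c_ge0.
- move=> _ _ [s oks ->] [s' oks' ->]; exists (s ++ s') => /=.
    by move=> t; rewrite mem_cat => /orP[/oks|/oks'].
  by rewrite /cert_vec /cert_val !big_cat.
- move=> t _ t0 [s oks ->]; exists [seq (t * v.1.1, v.1.2, v.2) | v <- s] => /=.
    move=> _ /mapP[v vs ->] /=; have [h1 h2 h3] := oks v vs.
    by split => //; rewrite mulr_gt0.
  rewrite /cert_vec /cert_val !big_map scaler_sumr mulr_sumr.
  congr (_, _); apply: eq_bigr => v _ /=; first by rewrite scalerA.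
  by rewrite mulrA.
- move=> _ [s oks ->] /=; rewrite leNgt; apply/negP => h; apply: nc.
  by exists s; split => //; lra.
exists p => // k u fu uy.
have := pK (u - y, fine (f u) - a + `|u - y| / k.+1%:R); apply.
exists [:: (1, k, u)].
  by move=> t; rewrite inE => /eqP->.
by rewrite /cert_vec /cert_val !big_seq1 /= scale1r mul1r.
Qed.

Lemma no_certificate a y m s (p : {linear V -> R^o}) : dual_ball c p ->
  cert_ok m y s -> (forall t, t \in s ->
     p (t.2 - y) <= fine (f t.2) - a + `|t.2 - y| / t.1.2.+1%:R) ->
  0 <= cert_val a y s + c * `|cert_vec y s|.
Proof.
move=> pc ok ps.
have : p (cert_vec y s) <= cert_val a y s.
  rewrite /cert_vec linear_sum /cert_val big_seq [leRHS]big_seq.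
  apply: ler_sum => t ts; rewrite linearZ; apply: ler_wpM2l; last exact: ps.
  by have [/ltW] := ok t ts.
have := pc (cert_vec y s); rewrite ler_norml => /andP[h _]; lra.
Qed.

(** D is stable under sums, rational multiples, and the choice of a certificate valid
    on a whole rational neighbourhood of a point of D. If no subgradient existed on
    the whole space at y in the closure of D, there would be a certificate at
    (y, f y); by openness it is valid around some (d, q) with d in D and q rational, so
    that a certificate with points in D is valid at (y, f y) as well, and it
    contradicts the subgradient along the closure of D. *)
Lemma separable_reduction (x0 : V) : exists D : set V,
  [/\ countable D, D x0, (forall t y, closure D y -> closure D (t *: y)),
    (forall y z, closure D y -> closure D z -> closure D (y + z)) &
  forall y a, closure D y -> f y = a%:E ->
   (exists2 p, dual_ball c p & forall r, 0 < r -> exists2 d, 0 < d &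
      forall u, closure D u -> `|u - y| < d ->
        (a%:E <= f u + (r * `|u - y| - p (u - y))%:E)%E) ->
   exists2 p, dual_ball c p & forall r, 0 < r -> exists2 d, 0 < d &
      forall u, `|u - y| < d ->
        (a%:E <= f u + (r * `|u - y| - p (u - y))%:E)%E].
Proof.
pose robust M (a : R) (rho : R) d s := forall y' a', `|y' - d| < rho -> `|a' - a| < rho ->
  certificate M a' y' s.
have [pick pickP] : exists pick : seq nat * R * R * V -> seq (R * nat * V),
    forall q, (exists s, robust q.1.1.1 q.1.1.2 q.1.2 q.2 s) ->
      robust q.1.1.1 q.1.1.2 q.1.2 q.2 (pick q).
  suff /choice[pick ?] : forall q : seq nat * R * R * V, exists s',
    (exists s, robust q.1.1.1 q.1.1.2 q.1.2 q.2 s) ->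
      robust q.1.1.1 q.1.1.2 q.1.2 q.2 s' by exists pick.
  move=> q; have [[s hs]|ns] := pselect (exists s, robust q.1.1.1 q.1.1.2 q.1.2 q.2 s).
    by exists s.
  by exists [::] => /ns.
(* sums, rational multiples, and the j-th point of the certificate that is chosen
   around a given point for the list M, the value q and the radius 1 / (n + 1) *)
pose op (i : unit + rat + (seq nat * rat * nat * nat)) (l : seq V) : V :=
  match i with
  | inl (inl _) => nth 0 l 0 + nth 0 l 1
  | inl (inr q) => ratr q *: nth 0 l 0
  | inr (M, q, n, j) => nth x0 [seq t.2 | t <- pick (M, ratr q, n.+1%:R^-1, nth 0 l 0)] j
  end.
have [D [cD Dx0 Dop]] := countable_stable_set op x0.
have DD y z : D y -> D z -> D (y + z).
  move=> Dy Dz; apply: (Dop (inl (inl tt)) [:: y; z]) => t.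
  by rewrite !inE => /orP[/eqP->|/eqP->].
have DZ q y : D y -> D (ratr q *: y).
  move=> Dy; apply: (Dop (inl (inr q)) [:: y]) => t.
  by rewrite !inE => /eqP->.
have Dpick M q n y t : D y -> t \in pick (M, ratr q, n.+1%:R^-1, y) -> D t.2.
  move=> Dy ts.
  have := Dop (inr (M, q, n, index t.2 [seq t.2 | t <- pick (M, ratr q, n.+1%:R^-1, y)]))
    [:: y].
  rewrite /= nth_index ?map_f//; apply => v.
  by rewrite !inE => /eqP->.
have ratP (x r : R) : 0 < r -> exists q : rat, `|x - ratr q| < r.
  move=> r0; have [|q] := @rat_in_itvoo R (x - r) (x + r); first lra.
  rewrite in_itv /= => /andP[h1 h2]; exists q; rewrite ltr_norml; lra.
exists D; split => //.
- move=> t y /closure_normP cy; apply/closure_normP => r r0.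
  have t1 : 0 < `|t| + 1 by rewrite ltr_wpDl.
  have [d Dd yd] := cy (r / 2 / (`|t| + 1)) (divr_gt0 (divr_gt0 r0 (ltr0Sn _ 1)) t1).
  have d1 : 0 < `|d| + 1 by rewrite ltr_wpDl.
  have [q tq] := ratP t (r / 2 / (`|d| + 1)) (divr_gt0 (divr_gt0 r0 (ltr0Sn _ 1)) d1).
  exists (ratr q *: d); first exact: DZ.
  have -> : t *: y - ratr q *: d = t *: (y - d) + (t - ratr q) *: d.
    by rewrite scalerBr scalerBl addrA subrK.
  apply: le_lt_trans (ler_normD _ _) _; rewrite !normrZ.
  move: yd tq; rewrite !ltr_pdivlMr//.
  have := mulr_ge0 (normr_ge0 t) (normr_ge0 (y - d)).
  have := mulr_ge0 (normr_ge0 (t - ratr q)) (normr_ge0 d).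
  have := normr_ge0 (t - ratr q); have := normr_ge0 (y - d).
  lra.
- move=> y z /closure_normP cy /closure_normP cz; apply/closure_normP => r r0.
  have [d Dd yd] := cy (r / 2) (divr_gt0 r0 (ltr0Sn _ 1)).
  have [e De ze] := cz (r / 2) (divr_gt0 r0 (ltr0Sn _ 1)).
  exists (d + e); first exact: DD.
  rewrite opprD addrACA; apply: le_lt_trans (ler_normD _ _) _; lra.
move=> y a cy fya [p pc pY].
have small (r : R) : 0 < r -> exists k : nat, k.+1%:R^-1 < r.
  move=> r0; have [N _ H] := near_infty_natSinv_lt (PosNum r0).
  by exists N; exact: (H N (leqnn _)).
have /choice[m mP] : forall k : nat, exists j : nat, forall u, closure D u ->
    `|u - y| < j.+1%:R^-1 ->
    (a%:E <= f u + (k.+1%:R^-1 * `|u - y| - p (u - y))%:E)%E.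
  move=> k; have [|d d0 Hd] := pY k.+1%:R^-1; first by rewrite invr_gt0.
  have [j jd] := small d d0; exists j => u cu uj; apply: Hd => //.
  exact: lt_trans jd.
have [[p' pc' p'P]|[s [ok neg]]] := subgradient_or_certificate a y m.
  exists p' => // r r0; have [k kr] := small r r0.
  exists (m k).+1%:R^-1; first by rewrite invr_gt0.
  move=> u uy; have [fu|fu] := boolP (f u \is a fin_num); last first.
    have : f u = +oo%E by apply/eqP; move: fu; rewrite ge0_fin_numE// -leNgt leye_eq.
    by move=> ->; rewrite addye// leey.
  have := p'P k u fu uy; rewrite -[in f u](fineK fu) -EFinD lee_fin.
  have : k.+1%:R^-1 * `|u - y| <= r * `|u - y| by apply: ler_wpM2r => //; exact: ltW.
  rewrite [`|u - y| / _]mulrC; move: (k.+1%:R^-1 * _) (r * _) => A B; lra.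
pose N := (\max_(t <- s) t.1.2).+1.
have cert : certificate (mkseq m N) a y s.
  have tN t : t \in s -> (t.1.2 < N)%N.
    by move=> ts; rewrite ltnS; apply: leq_bigmax_seq.
  split => //; last by move=> t /tN; rewrite size_mkseq.
  by move=> t ts; rewrite nth_mkseq ?tN//; exact: ok.
have [r r0 Hr] := certificate_open cert.
have r2 : 0 < r / 2 by lra.
have [n nr] := small _ r2.
have n0 : 0 < n.+1%:R^-1 :> R by rewrite invr_gt0.
have [d Dd yd] := (closure_normP D y).1 cy _ n0.
have [q aq] := ratP a _ n0.
have : robust (mkseq m N) (ratr q) n.+1%:R^-1 d s.
  move=> y' a' y'd a'q; apply: Hr.
    have -> : y - y' = (y - d) - (y' - d) by rewrite opprB addrA subrK.
    apply: le_lt_trans (ler_normB _ _) _; apply: lt_trans (ltrD yd y'd) _.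
    by apply: lt_le_trans (ltrD nr nr) _; lra.
  have -> : a - a' = (a - ratr q) - (a' - ratr q) by ring.
  apply: le_lt_trans (ler_normB _ _) _; apply: lt_trans (ltrD aq a'q) _.
  by apply: lt_le_trans (ltrD nr nr) _; lra.
move=> hs; have := pickP (mkseq m N, ratr q, n.+1%:R^-1, d) (ex_intro _ s hs).
move=> /(_ y a yd aq) /= [ok' sN neg'].
have := no_certificate (a := a) pc ok'; rewrite leNgt neg'; case/(_ _)/notF.
move=> t ts; have Dt := Dpick _ _ _ _ _ Dd ts.
have [_ ft ty] := ok' t ts; have := sN t ts; rewrite size_mkseq => tN.
move: ty; rewrite nth_mkseq// => ty.
have := mP t.1.2 t.2 (subset_closure Dt) ty.
rewrite -[in f _](fineK ft) -EFinD lee_fin [`|_| / _]mulrC; move: (_^-1 * _) => A; lra.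
Qed.

End SeparableReduction.

(** * The Frechet slope in Asplund spaces *)

Section FrechetSubgradients.
Context {R : realType} {V : normedModType R}.
Implicit Types (p : {linear V -> R^o}).

Lemma frechet_subdiffP (f : V -> \bar R) u (b c : R) p : f u = b%:E ->
  dual_ball c p ->
  (forall r, 0 < r -> \forall y \near u,
     (b%:E <= f y + (r * `|y - u| - p (y - u))%:E)%E) ->
  frechet_subdiff f u p.
Proof.
move=> fu pc H; split; first by rewrite fu ltry.
  exact: dual_ball_continuous pc.
apply/lee_addgt0Pr => r r0; rewrite -leeBlDr// add0e limf_einfE.
apply: le_ereal_sup_tmp; eexists.
  exists [set y | (b%:E <= f y + (r * `|y - u| - p (y - u))%:E)%E /\ y != u];
    last reflexivity.
  by rewrite /dnbhs /within /=; apply: filterS (H r r0) => y hy yu; split.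
apply: le_ereal_inf_tmp => _ [y [hy yu] <-].
have d0 : 0 < `|y - u| by rewrite normr_gt0 subr_eq0.
rewrite inver gt_eqF// fu.
move: hy; case: (f y) => [s| |].
- rewrite -EFinD lee_fin => hy.
  rewrite -!EFinB -EFinM lee_fin ler_pdivlMr//; lra.
- move=> _; rewrite [X in (_ <= X)%E](_ : _ = +oo%E) ?leey//.
  by rewrite !addye// mulyr gtr0_sg ?invr_gt0// mul1e.
- by rewrite addNye leeNy_eq.
Qed.

(** Completeness of the dual, obtained from a weak-star limit. *)
Lemma limit_functional (g : nat -> {linear V -> R^o}) (tau : nat -> R) c :
  (forall i, dual_ball c (g i)) ->
  (forall i j x, (i <= j)%N -> `|g j x - g i x| <= tau i * `|x|) ->
  exists2 p : {linear V -> R^o}, dual_ball c p &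
    forall i x, `|p x - g i x| <= tau i * `|x|.
Proof.
move=> gc gtau.
have PF : ProperFilter (g @ \oo) by exact: fmap_proper_filter.
have [U [UU FU]] := ultraFilterLemma PF.
have Uc : U (dual_ball c) by apply: FU; exists 0%N => // j _; exact: gc.
have [p pc Up] := weakstar_limit UU Uc.
exists p => // i x; apply/ler_addgt0Pr => e e0.
have Ui : U [set q | exists2 j, (i <= j)%N & q = g j].
  by apply: FU; exists i => // j /= ij; exists j.
have [q [[j ij ->] /= h]] := filter_ex (filterI Ui (Up x _ e0)).
have -> : p x - g i x = (g j x - g i x) - (g j x - p x).
  by ring.
apply: le_trans (ler_normB _ _) _; apply: lerD; last exact: ltW.
exact: gtau.
Qed.

End FrechetSubgradients.

Section Asplund.
Context {R : realType} {V : completeNormedModType R}.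
Implicit Types (p : {linear V -> R^o}).

Lemma asplund_subspace (D : set V) : asplund V -> countable D -> D !=set0 ->
  (forall t y, closure D y -> closure D (t *: y)) ->
  (forall y z, closure D y -> closure D z -> closure D (y + z)) ->
  separable_dual (closure D).
Proof.
move=> aV cD [d Dd] cZ cA; apply: aV; last first.
  by exists D; split => //; exact: subset_closure.
split; first by rewrite inE -(scale0r d); apply: cZ; exact: subset_closure.
by move=> t y z; rewrite !inE => cy cz; apply: cA => //; exact: cZ.
Qed.

(** The variational principle is applied with smooth gauges on a rich separable
    subspace. At the minimizer u each gauge has a supergradient; minus their
    weighted sum is a Frechet subgradient of F along the subspace, of norm at most the
    total mass c, and separable reduction then yields one on V. *)
Lemma frechet_variational (F : V -> \bar R) x0 (sigma c a m : R) : asplund V ->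
  complete_space (normed_metric V) -> lower_semicontinuous F ->
  (forall x, 0 <= F x)%E -> 0 < sigma < c -> F x0 = a%:E -> a < m ->
  exists u (b : R), [/\ F u = b%:E, b + sigma * `|u - x0| <= m &
    exists2 p, dual_ball c p & forall r, 0 < r -> exists2 d, 0 < d &
      forall y, `|y - u| < d -> (b%:E <= F y + (r * `|y - u| - p (y - u))%:E)%E].
Proof.
move=> aV cX Fl F0 sc Fx0 am.
have c0 : 0 < c by lra.
have k0 : 0 < (m - a) / c by rewrite divr_gt0// subr_gt0.
have [D [cD Dx0 cZ cA Dred]] := separable_reduction (ltW c0) F0 x0.
have D0 : D !=set0 by exists x0.
have [theta thetaP] := separable_dual_smooth_norm cZ D0 cD (@subset_closure _ D)
  (fun _ h => h) (asplund_subspace aV cD D0 cZ cA).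
pose tau := geometric_tail c sigma.
have [|||||v [u [Yu h1 h2]]] := @variational_principle R (normed_metric V) tau
  (fun e x y => theta e (x - y)) _ (fun i => geometric_tail_dec i sc) k0
  _ _ _ F (closure D) x0 a m cX (@closed_closure _ D) Fl F0
  (fun i => geometric_tail_gt0 i sc) _ Fx0.
- move=> e x x' y e0; have [h _ _ _] := thetaP _ e0; apply: le_trans (h _ (x' - y)) _.
  by rewrite opprB addrA subrK.
- by move=> e x y e0; have [_ h _ _] := thetaP _ e0; exact: h.
- move=> e y e0; have [_ _ h _] := thetaP _ e0.
  by rewrite subrr; apply: le_trans (h _) _; rewrite normr0.
- exact: subset_closure.
- by rewrite /tau /= divfK ?gt_eqF//; lra.
have Fu : F u \is a fin_num.
  rewrite ge0_fin_numE//; move: h1; case: (F u) => [s|//|//]; first by rewrite ltry.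
exists u, (fine (F u)); split; first by rewrite fineK.
  move: h1; rewrite -(fineK Fu) -EFinD lee_fin /= expr0 mulr1 opprB.
  by rewrite [c + _]addrC subrK.
apply: (Dred _ _ Yu); first by rewrite fineK.
pose prec i : R := (m - a) / c * 2^-1 ^+ i.
have prec0 i : 0 < prec i by rewrite mulr_gt0// exprn_gt0// invr_gt0.
have /choice[q qP] : forall i, exists p, dual_ball 1 p /\ forall r, 0 < r ->
    exists2 d, 0 < d & forall y, closure D y -> `|y| < d ->
      theta (prec i) (u - v i + y) <= theta (prec i) (u - v i) + p y + r * `|y|.
  move=> i; have [_ _ _ h] := thetaP _ (prec0 i).
  by have [p p1 pP] := h (u - v i); exists p.
pose wt i := tau i - tau i.+1.
have wt0 i : 0 < wt i by rewrite subr_gt0; exact: geometric_tail_dec.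
have /choice[g gE] : forall i, exists g : {linear V -> R^o},
    forall x, g x = \sum_(j < i) wt j * q j x.
  move=> i; apply: linear_of_fun => t x y.
  change (\sum_(j < i) wt j * q j (t *: x + y) =
     t * (\sum_(j < i) wt j * q j x) + \sum_(j < i) wt j * q j y).
  rewrite mulr_sumr -big_split /=; apply: eq_bigr => j _.
  rewrite linearP.
  change (wt j * (t * q j x + q j y) = t * (wt j * q j x) + wt j * q j y).
  by ring.
have gS i x : g i.+1 x = g i x + wt i * q i x by rewrite !gE big_ord_recr.
have tau0 i : 0 < tau i by exact: geometric_tail_gt0.
have glip i j x : (i <= j)%N -> `|g j x - g i x| <= (tau i - tau j) * `|x|.
  elim: j => [|j IH]; first by rewrite leqn0 => /eqP->; rewrite !subrr normr0 mul0r.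
  rewrite leq_eqVlt ltnS => /orP[/eqP->|/IH {}IH]; first by rewrite !subrr normr0 mul0r.
  have -> : g j.+1 x - g i x = (g j x - g i x) + wt j * q j x by rewrite gS addrAC.
  apply: le_trans (ler_normD _ _) _; rewrite normrM (gtr0_norm (wt0 j)).
  have : wt j * `|q j x| <= wt j * `|x|.
    by apply: ler_wpM2l; [exact: ltW|have := (qP j).1 x; rewrite mul1r].
  by move: IH; rewrite /wt; lra.
have [|i j x ij|P Pc Ptau] := @limit_functional R V g tau c.
- move=> i x; have := glip 0%N i x (leq0n _).
  rewrite [g 0%N x]gE big_ord0 subr0 => /le_trans; apply.
  by apply: ler_wpM2r => //; rewrite /tau /= gerBl ltW.
- apply: le_trans (glip _ _ _ ij) _; apply: ler_wpM2r => //.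
  by rewrite gerBl ltW.
have [p pE] : exists p, forall x, p x = - P x.
  apply: linear_of_fun => t x y; change (- P (t *: x + y) = t * - P x + - P y).
  by rewrite linearP opprD mulrN.
exists p => [x|r r0]; first by rewrite pE normrN; exact: Pc.
have r3 : 0 < r / 3 by lra.
(* r / 3 each for the head of the sum, of mass c, for the mass tau i of its tail,
   and for the distance of g i to its limit P *)
have s0 : 0 < r / 3 / c by rewrite divr_gt0.
have [i ir] : exists i, tau i <= r / 3.
  have [N _ H] := half_expn_small (c - sigma) r3.
  by exists N.+1; apply: ltW; exact: (H N (leqnn _)).
pose Phi i (y : V) : R := @perturbation R (normed_metric V) tau
  (fun e x y => theta e (x - y)) ((m - a) / c) v i y.
have Phi0 y : Phi 0%N y = 0 by exact: perturbation0.
have PhiS j y : Phi j.+1 y = Phi j y + wt j * theta (prec j) (y - v j).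
  exact: perturbationS.
have [d d0 Hd] : exists2 d, 0 < d & forall y, closure D y -> `|y| < d ->
    Phi i (u + y : V) <= Phi i u + g i y + r / 3 / c * (c - tau i) * `|y|.
  elim: i {ir} => [|i [d1 d10 H1]].
    exists 1 => // y _ _; rewrite !Phi0 gE big_ord0.
    by rewrite /tau /= subrr mulr0 mul0r !addr0.
  have [d2 d20 H2] := (qP i).2 _ s0.
  exists (Num.min d1 d2); first by rewrite lt_min d10.
  move=> y cy; rewrite lt_min => /andP[y1 y2].
  rewrite !PhiS gS [u + y - v i]addrAC.
  have := H1 y cy y1; have := H2 y cy y2.
  rewrite -(ler_pM2l (wt0 i)).
  have -> : c - tau i.+1 = (c - tau i) + wt i by rewrite /wt; ring.
  move: (Phi _ _) (Phi _ _).
  move: (theta _ _) (theta _ _) (q i y) (g i y) (wt i) (r / 3 / c) => A B C E W S X Z.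
  lra.
exists d => // y cy yd.
have cyu : closure D (y - u) by apply: cA => //; rewrite -scaleN1r; exact: cZ.
have := h2 i y cy; rewrite -/(Phi i u) -/(Phi i y).
have := Hd _ cyu yd; rewrite [u + _]addrC subrK => Hy.
have [fy|fy] := boolP (F y \is a fin_num); last first.
  have -> : F y = +oo%E by apply/eqP; move: fy; rewrite ge0_fin_numE// -leNgt leye_eq.
  by move=> _; rewrite addye// leey.
rewrite -(fineK Fu) -(fineK fy) -!EFinD !lee_fin pE.
change (mdist (y : normed_metric V) u) with `|y - u|.
have := Ptau i (y - u); rewrite ler_norml => /andP[hP _].
have hr : tau i * `|y - u| <= r / 3 * `|y - u| by apply: ler_wpM2r.
have hs : r / 3 / c * (c - tau i) * `|y - u| <= r / 3 * `|y - u|.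
  apply: ler_wpM2r => //; rewrite -[leRHS](divfK (lt0r_neq0 c0)).
  by apply: ler_wpM2l; [exact: ltW|rewrite gerBl ltW].
move: Hy hs hP hr.
move: (Phi _ _) (Phi _ _) => A B.
move: (r / 3 / c * _ * _) (tau i * _) (g i _) (P _) => S T G Q.
lra.
Qed.

Lemma ekeland_frechet_slope : asplund V ->
  @ekeland_property R (normed_metric V) (@frechet_slope R V).
Proof.
move=> aV f x0 sigma c a m cX _ fl sc a0 fa am.
have c0 : 0 <= c by lra.
have F0 x : (0 <= maxe (f x) 0)%E by rewrite le_max lexx orbT.
have Fx0 : (maxe (f x0) 0)%E = a%:E by rewrite fa; apply/max_idPl; rewrite lee_fin.
have [u [b [Fu um [p pc pP]]]] := frechet_variational aV cX (lsc_maxe0 fl) F0 sc Fx0 am.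
exists u; first by rewrite Fu -EFinD lee_fin.
move=> fu0; have fu : f u = b%:E by rewrite -Fu (max_idPl (ltW fu0)).
have [U uU Uf] := fl _ _ fu0.
apply: (@subdiff_slope_le R V _ c p) => //.
apply: (frechet_subdiffP fu pc) => r r0; have [d d0 Hd] := pP _ r0.
apply: filterS (filterI uU (nbhsx_ballx u _ d0)) => y [Uy].
rewrite -ball_normE /= distrC => yd; have := Hd _ yd.
by rewrite (max_idPl (ltW (Uf _ Uy))).
Qed.

End Asplund.

(** * Error bounds *)

Section ErrorBounds.
Context {R : realType}.

Lemma slope_operator_ekeland (X : metricType R) (s : (X -> \bar R) -> X -> \bar R) :
  slope_operator s -> ekeland_property s.
Proof.
by case=> [Y|Y|V|V aV]; [exact: ekeland_nonlocal_slope|exact: ekeland_slope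
  |exact: ekeland_clarke_slope|exact: ekeland_frechet_slope].
Qed.

Context {X : metricType R}.
Implicit Types (f : X -> \bar R) (x u : X).

Lemma dist_to_ge (A : set X) x (L : R) :
  (forall v, A v -> L <= mdist x v) -> (L%:E <= dist_to A x)%E.
Proof.
by move=> H; apply: le_ereal_inf_tmp => _ [v Av <-]; rewrite lee_fin; exact: H.
Qed.

Lemma dist_to_le (A : set X) x v : A v -> (dist_to A x <= (mdist x v)%:E)%E.
Proof. by move=> Av; apply: ge_ereal_inf; eexists; first by exists v. Qed.

Lemma lt_dist_to (A : set X) x (a tau : R) : 0 < tau ->
  (a%:E < tau%:E * dist_to A x)%E ->
  exists2 L : R, a < tau * L & forall v, A v -> L < mdist x v.
Proof.
move=> t0 h.
have [L aL Ld] : exists2 L : R, a < tau * L & (L%:E < dist_to A x)%E.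
  move: h; case: (dist_to A x) => [r| |].
  - rewrite -EFinM lte_fin => ar.
    exists ((a / tau + r) / 2).
      have : a / tau < r by rewrite ltr_pdivrMr// mulrC.
      rewrite -(ltr_pM2l t0); have : tau * (a / tau) = a by rewrite mulrC divfK// gt_eqF.
      lra.
    by rewrite lte_fin; have : a / tau < r; [rewrite ltr_pdivrMr// mulrC|lra].
  - move=> _; exists (a / tau + 1); last exact: ltry.
    by rewrite mulrDr mulrCA divff ?gt_eqF// mulr1; lra.
  - by rewrite mulrNy gtr0_sg// mul1e.
exists L => // v Av; rewrite -lte_fin; exact: lt_le_trans Ld (dist_to_le _ Av).
Qed.

Lemma fin_strip f (mu : \bar R) x : strip f mu x -> exists2 a, f x = a%:E & 0 < a.
Proof.
move=> [f0 fmu]; case: (f x) f0 fmu => [a| |] //.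
  by rewrite lte_fin => a0 _; exists a.
by move=> _; rewrite ltNge leey.
Qed.

Lemma ekeland_error_bound f xbar (alpha tau : R) (delta mu : \bar R) s :
  0 < tau -> never_ninfty f -> complete_space X -> lower_semicontinuous f ->
  0 < alpha <= 1 -> nonpos_set f xbar \/ delta = +oo%E -> ekeland_property s ->
  (forall u, eball xbar delta u -> strip f mu u ->
     (Num.max alpha (1 - alpha))%:E * f u < tau%:E * dist_to (nonpos_set f) u ->
     tau%:E <= alpha%:E * s f u)%E ->
  error_bound f xbar tau (delta / (1 + alpha)%:E)%E mu.
Proof.
move=> t0 nf cX fl /andP[al0 al1] xbarS sE H.
have al2 : 0 < 1 + alpha by lra.
split; last first.
  case: xbarS => [?|->]; [by left|right].
  by rewrite inver gt_eqF// mulyr gtr0_sg ?mul1e// invr_gt0.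
move=> x xball xstrip; rewrite leNgt; apply/negP => lt_dist.
have [a fa a0] := fin_strip xstrip.
rewrite fa in lt_dist; have [L aL LS] := lt_dist_to t0 lt_dist.
have L0 : 0 < L by rewrite -(pmulr_rgt0 L t0); exact: lt_trans aL.
have alL : 0 < alpha * L by exact: mulr_gt0.
have [sigma [c [k_lt sc c_lt]]] : exists sigma c, [/\ a < sigma * (alpha * L),
    0 < sigma < c & alpha * c < tau].
  have kK : a / (alpha * L) < tau / alpha.
    by rewrite ltr_pdivrMr// mulrA divfK ?gt_eqF.
  have k0 : 0 < a / (alpha * L) by exact: divr_gt0.
  exists ((2 * (a / (alpha * L)) + tau / alpha) / 3),
    ((a / (alpha * L) + 2 * (tau / alpha)) / 3); split.
  - by rewrite -ltr_pdivrMr//; lra.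
  - lra.
  - by rewrite mulrC -ltr_pdivlMr//; lra.
have [m [am mL mmu]] : exists m, [/\ a < m, m <= sigma * (alpha * L) & (m%:E < mu)%E].
  have := xstrip.2; rewrite fa; case: mu {H xstrip} => [r| |//].
    rewrite lte_fin => ar; exists (Num.min (sigma * (alpha * L)) ((a + r) / 2)).
    rewrite lt_min k_lt ge_min lexx lte_fin gt_min; split => //; first lra.
    by apply/orP; right; lra.
  by move=> _; exists (sigma * (alpha * L)); rewrite ltry.
have [u um us] := sE f x sigma c a m cX nf fl sc (ltW a0) fa am.
have /andP[s0 _] := sc.
have fu0le : (0 <= maxe (f u) 0)%E by rewrite le_max lexx orbT.
have d_le : mdist u x <= alpha * L.
  rewrite -(ler_pM2l s0); apply: le_trans mL; rewrite -lee_fin.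
  by apply: le_trans um; rewrite leeDr.
have d_leL : mdist u x <= L by apply: le_trans d_le _; rewrite ler_piMl// ltW.
have fu0 : (0 < f u)%E.
  rewrite ltNge; apply/negP => fu; have := LS u fu.
  by rewrite metric_sym ltNge d_leL.
move: um; rewrite (max_idPl (ltW fu0)).
case fuE : (f u) fu0 => [b| |//]; last by rewrite addye// leye_eq.
rewrite lte_fin -EFinD lee_fin => b0 bm.
have uball : eball xbar delta u.
  rewrite /eball /=; case: xbarS => [xS|->]; last exact: ltry.
  have := LS _ xS => Lx; move: xball; rewrite /eball /= inver gt_eqF// lte_pdivlMr//.
  apply: le_lt_trans; rewrite -EFinM lee_fin.
  have := metric_triangle xbar x u; rewrite (metric_sym x u) (metric_sym xbar x).
  have : alpha * L <= alpha * mdist x xbar by apply: ler_wpM2l; exact: ltW.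
  lra.
have ustrip : strip f mu u.
  rewrite /strip /= fuE lte_fin b0; split => //.
  apply: le_lt_trans mmu; rewrite lee_fin.
  by have := mulr_ge0 (ltW s0) (mdist_ge0 u x); lra.
have := us; rewrite fuE lte_fin => /(_ b0) sc'.
have : (tau%:E <= alpha%:E * s f u)%E.
  apply: H => //; apply: (@lt_le_trans _ _ (tau * (L - mdist u x))%:E); last first.
    rewrite EFinM; apply: lee_wpmul2l; first by rewrite lee_fin ltW.
    apply: dist_to_ge => v vS; have := LS v vS.
    by have := metric_triangle x u v; rewrite (metric_sym x u); lra.
  rewrite fuE -EFinM lte_fin.
  (* f u <= sigma (alpha L - d(u, x)), while d(u, S) >= L - d(u, x) *)
  have bs : b <= sigma * (alpha * L - mdist u x) by lra.
  have ad : 0 < alpha * L - mdist u x.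
    by rewrite -(pmulr_rgt0 _ s0); exact: lt_le_trans bs.
  have sal : sigma * alpha < tau.
    apply: lt_trans c_lt; rewrite mulrC ltr_pM2l//; by case/andP: sc.
  have h1 : alpha * b < tau * (L - mdist u x).
    apply: (@lt_le_trans _ _ (tau * (alpha * L - mdist u x))).
      apply: (@le_lt_trans _ _ (sigma * alpha * (alpha * L - mdist u x))).
        by rewrite [sigma * alpha]mulrC -mulrA ler_pM2l.
      by rewrite ltr_pM2r.
    by rewrite ler_pM2l// lerD2r ler_piMl// ltW.
  have [al_eq|al_neq] := eqVneq alpha 1.
    by move: h1; rewrite al_eq subrr /Num.max; case: ifP => // _; lra.
  have al_lt : 0 < 1 - alpha by rewrite subr_gt0 lt_neqAle al_neq.
  rewrite maxEle; case: ifP => // _.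
  apply: (@lt_le_trans _ _ ((1 - alpha) * (tau * L))).
    rewrite ltr_pM2l//; apply: (@le_lt_trans _ _ (sigma * alpha * L)).
      apply: le_trans bs _; rewrite -mulrA ler_pM2l// gerBl.
      exact: mdist_ge0.
    by rewrite ltr_pM2r.
  by rewrite mulrCA ler_pM2l//; lra.
rewrite leNgt => /negP; apply.
apply: (@le_lt_trans _ _ (alpha * c)%:E); last by rewrite lte_fin.
by rewrite EFinM; apply: lee_wpmul2l => //; rewrite lee_fin ltW.
Qed.

(** If b were 0, then S would be empty since a > 0, and the error bound would make f u
    infinite. For b > 0 the hypothesis says a / b <= d(u, S), to be compared with
    tau * d(u, S) <= a. *)
Lemma error_bound_growth f xbar (tau : R) (delta mu : \bar R) u (a b : R) :
  0 < tau -> error_bound f xbar tau delta mu -> eball xbar delta u ->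
  strip f mu u -> f u = a%:E -> 0 < a -> 0 <= b ->
  (forall v, nonpos_set f v -> a <= b * mdist u v) -> tau <= b.
Proof.
move=> t0 [eb _] ub us fu a0 b0 H.
have := eb u ub us; rewrite fu => td; rewrite leNgt; apply/negP => bt.
have [b_0|bneq] := eqVneq b 0.
  have : (nonpos_set f) = set0.
    by apply/seteqP; split => // v /H; rewrite b_0 mul0r leNgt a0.
  move=> S0; move: td; rewrite S0 /dist_to image_set0 ereal_inf0 mulry gtr0_sg// mul1e.
  by rewrite leye_eq.
have bp : 0 < b by rewrite lt_neqAle eq_sym bneq.
have : ((a / b)%:E <= dist_to (nonpos_set f) u)%E.
  by apply: dist_to_ge => v /H; rewrite ler_pdivrMr// mulrC.
move=> /(lee_wpmul2l (ltW t0 : 0 <= tau%:E)%E)/le_trans/(_ td).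
rewrite -EFinM lee_fin mulrA ler_pdivrMr// mulrC ler_pM2l//.
by rewrite leNgt bt.
Qed.

Lemma error_bound_nonlocal_slope f xbar (tau : R) (delta mu : \bar R) u :
  0 < tau -> error_bound f xbar tau delta mu -> eball xbar delta u ->
  strip f mu u -> (tau%:E <= nonlocal_slope f u)%E.
Proof.
move=> t0 eb ub us; have [a fu a0] := fin_strip us.
rewrite /nonlocal_slope fu /=; set S := ereal_sup _.
have : (0 <= maxe 0 S)%E by rewrite le_max lexx.
case E : (maxe 0 S)%E => [b| |//]; last by move=> _; rewrite leey.
rewrite !lee_fin => b0; apply: (error_bound_growth t0 eb ub us fu a0 b0).
move=> v vS; have vu : v != u.
  by apply/eqP => vu; move: vS; rewrite vu /nonpos_set /= fu lee_fin leNgt a0.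
have d0 : 0 < mdist v u by rewrite mdist_gt0.
rewrite metric_sym -ler_pdivrMr// -lee_fin -E le_max; apply/orP; right.
apply: le_ereal_sup_tmp; eexists; first by exists v.
rewrite (max_idPr vS) sube0 (max_idPr (ltW _)) ?lte_fin//.
by rewrite inver gt_eqF// -EFinM.
Qed.

End ErrorBounds.

Lemma error_bound_convex_slope (R : realType) (V : normedModType R)
    (f : normed_metric V -> \bar R) (xbar u : normed_metric V)
    (tau : R) (delta mu : \bar R) :
  0 < tau -> error_bound f xbar tau delta mu -> eball xbar delta u ->
  strip f mu u -> (tau%:E <= convex_slope (f : V -> \bar R) u)%E.
Proof.
move=> t0 eb ub us; have [a fu a0] := fin_strip us.
apply: le_ereal_inf_tmp => _ [p [_ _ psub] <-].
have : (0 <= functional_norm setT p)%E.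
  apply: le_ereal_sup_tmp; exists `|p 0|%:E; last by rewrite lee_fin.
  by exists 0 => //; split; rewrite // normr0.
case E : (functional_norm setT p) => [b| |//]; last by move=> _; rewrite leey.
rewrite !lee_fin => b0; apply: (error_bound_growth t0 eb ub us fu a0 b0).
move=> v; rewrite /nonpos_set /= => fv.
have vu : (v : V) != u.
  by apply/eqP => vu; move: fv; rewrite vu fu lee_fin leNgt a0.
have d0 : 0 < `|(u : V) - v| by rewrite normr_gt0 subr_eq0 eq_sym.
change (a <= b * `|(u : V) - v|).
have h1 : a <= p ((u : V) - v).
  have := psub v; rewrite fu -[(v : V) - u]opprB linearN.
  case: (f v) fv => [r| |] //.
  rewrite -!EFinD !lee_fin; lra.
apply: le_trans h1 _; rewrite -ler_pdivrMr// -lee_fin -E.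
apply: le_ereal_sup_tmp; exists `|p (`|(u : V) - v|^-1 *: ((u : V) - v))|%:E.
  eexists; last reflexivity; split => //.
  by rewrite normrZ gtr0_norm ?invr_gt0// mulVf// gt_eqF.
rewrite lee_fin linearZ; apply: le_trans (ler_norm _); rewrite mulrC.
by [].
Qed.

Local Open Scope ereal_scope.

Theorem theorem3p2 (R : realType) (tau : R) (delta mu : \bar R)
    (tau_gt0 : (0 < tau)%R) (delta_gt0 : 0 < delta) (mu_gt0 : 0 < mu) :
  [/\
    (forall (X : metricType R) (f : X -> \bar R) (xbar : X) (alpha : R)
        (s : (X -> \bar R) -> X -> \bar R),
      never_ninfty f -> complete_space X -> lower_semicontinuous f ->
      (0 < alpha <= 1)%R ->
      nonpos_set f xbar \/ delta = +oo ->
      slope_operator s ->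
      (forall u, eball xbar delta u -> strip f mu u ->
         (Num.max alpha (1 - alpha))%:E * f u
           < tau%:E * dist_to (nonpos_set f) u ->
         tau%:E <= alpha%:E * s f u) ->
      error_bound f xbar tau (delta / (1 + alpha)%:E) mu),
    (forall (X : metricType R) (f : X -> \bar R) (xbar : X),
      never_ninfty f ->
      error_bound f xbar tau delta mu ->
      forall u, eball xbar delta u -> strip f mu u ->
        tau%:E <= nonlocal_slope f u) &
    (forall (V : normedModType R) (f : normed_metric V -> \bar R)
        (xbar : normed_metric V),
      never_ninfty f -> econvex (f : V -> \bar R) ->
      error_bound f xbar tau delta mu ->
      forall u, eball xbar delta u -> strip f mu u ->
        tau%:E <= convex_slope (f : V -> \bar R) u)].
Proof.
split.
- move=> X f xbar alpha s nf cX fl al xb sS H.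
  exact: ekeland_error_bound (slope_operator_ekeland sS) H.
- by move=> X f xbar _ eb u; exact: error_bound_nonlocal_slope eb.
- by move=> V f xbar _ _ eb u; exact: error_bound_convex_slope eb.
Qed.
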